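(* Let $n\geq 1$ and $1\leq k,r\leq n$. Let $\lambda$ be a partition of $r$ with $\lambda\neq(1^r)$, so that $S(\lambda)$ is a simple $\mathbb C\mathfrak S_r$-module, and let $\mu$ be a partition of $k$, so that $S(\mu)$ is a simple $\mathbb C\mathfrak S_k$-module. Then $\operatorname{Ext}^m_{\mathbb C\mathfrak T_n}(L(\lambda),L(\mu))=0$ unless $0\leq m\leq r-k\leq n-1$.
   Context: $\mathfrak T_n$ is the monoid of all self-maps of $[n]=\{1,\ldots,n\}$ under composition. All modules are left modules. For $1\leq r\leq n$, $e_r\in\mathfrak T_n$ is the idempotent with $e_r(i)=i$ for $i\leq r$ and $e_r(i)=1$ for $i>r$; $G_{e_r}$ is the group of units of the monoid $e_r\mathfrak T_ne_r$, identified with the symmetric group $\mathfrak S_r$ via $g\mapsto g|_{[r]}$. For a partition $\lambda$ of $r$, $S(\lambda)$ is the Specht module of $\mathfrak S_r$ over $\mathbb C$, with the convention that $S((r))$ is trivial and $S((1^r))$ is the sign representation, where $(1^r)=(1,\ldots,1)$ with $r$ ones. $L(\lambda)$ denotes the unique (up to isomorphism) simple $\mathbb C\mathfrak T_n$-module that is annihilated by all maps of rank (image size) less than $r$ and satisfies $e_rL(\lambda)\cong S(\lambda)$ as $\mathbb CG_{e_r}$-modules. *)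

(* Defs.v *)
(* MathComp, with the classical layer and the real numbers of MathComp-Analysis. *)
From HB Require Import structures.
From mathcomp Require Import all_boot all_order all_algebra.
From mathcomp Require Import fingroup perm.
From mathcomp Require Import complex.
From mathcomp Require Import boolp classical_sets functions reals.
From mathcomp Require Import freeg.

Set Implicit Arguments.
Unset Strict Implicit.
Unset Printing Implicit Defensive.

Import GRing.Theory.

Local Open Scope ring_scope.

Definition projective (A : nzRingType) (P : lmodType A) : Prop :=
  forall (U V : lmodType A) (g : {linear U -> V}) (f : {linear P -> V}),
    (forall v, exists u, g u = v) ->
    exists h : {linear P -> U}, forall x, g (h x) = f x.

Record projres (A : nzRingType) (M : lmodType A) := ProjRes {
  pr_obj :> nat -> lmodType A;
  pr_diff : forall m, {linear pr_obj m.+1 -> pr_obj m};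
  pr_aug : {linear pr_obj 0%N -> M};
  pr_projective : forall m, projective (pr_obj m);
  pr_exact_diff : forall m (x : pr_obj m.+1),
    pr_diff m x = 0 <-> exists y, pr_diff m.+1 y = x;
  pr_exact_aug : forall x : pr_obj 0%N,
    pr_aug x = 0 <-> exists y, pr_diff 0%N y = x;
  pr_aug_surj : forall y, exists x, pr_aug x = y
}.
Arguments pr_diff {A M} p m.
Arguments pr_aug {A M} p.

Section Ext.
Variables (A : nzRingType) (M N : lmodType A) (P : projres M).

Definition is_cocycle m : {pred (P m -> N)} :=
  [pred f : P m -> N | `[< linear f /\ forall x, f (pr_diff P m x) = 0 >]].
Arguments is_cocycle m _ : clear implicits.

Lemma is_cocycle_zmod_closed m : zmod_closed (is_cocycle m).
Proof.
split=> [|f g /asboolP[lf df] /asboolP[lg dg]]; apply/asboolP.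
  by split=> [a x y|x] /=; rewrite /GRing.zero /= ?scaler0 ?addr0.
have fgE x : (f - g) x = f x - g x by [].
split=> [a x y|x]; last by rewrite fgE df dg subr0.
by rewrite !fgE lf lg scalerBr opprD addrACA.
Qed.

HB.instance Definition _ m :=
  GRing.isZmodClosed.Build (P m -> N) (is_cocycle m) (is_cocycle_zmod_closed m).

Record cocycle m := Cocycle {
  cocycle_val :> P m -> N;
  cocycleP : cocycle_val \in is_cocycle m
}.
HB.instance Definition _ m := [isSub for @cocycle_val m].
HB.instance Definition _ m := [Choice of cocycle m by <:].
HB.instance Definition _ m := [SubChoice_isSubZmodule of cocycle m by <:].

Definition is_coboundary m : (P m -> N) -> Prop :=
  match m with
  | 0 => fun f => f = 0
  | m'.+1 => fun f => exists g : {linear P m' -> N},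
                        forall x, f x = g (pr_diff P m' x)
  end.

Definition coboundary m : {pred cocycle m} :=
  [pred f : cocycle m | `[< is_coboundary (f : P m -> N) >]].
Arguments coboundary m _ : clear implicits.

Lemma coboundary_zmod_closed m : zmod_closed (coboundary m).
Proof.
have valB (f g : cocycle m) : cocycle_val (f - g) = cocycle_val f - cocycle_val g.
  exact: (raddfB (val : cocycle m -> _)).
split=> [|f g /asboolP cf /asboolP cg]; apply/asboolP.
  by case: m {valB} => [|m] //=; exists \0.
rewrite valB; move: (cocycle_val f) (cocycle_val g) cf cg => {valB f g} f g.
case: m f g => [|m] f g /=; first by move=> -> ->; rewrite subr0.
case=> f' ff' [g' gg']; exists (f' \- g') => x.
by rewrite /= -ff' -gg'.
Qed.

HB.instance Definition _ m :=
  GRing.isZmodClosed.Build (cocycle m) (coboundary m) (coboundary_zmod_closed m).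

(* Ext^m_A (M, N), as the cohomology H^m (Hom_A (P, N)) of a projective resolution
   P of M. *)
Definition Ext m : zmodType := Quotient.quot (coboundary m).

Lemma Ext_eq0P m : (forall e : Ext m, e = 0) <->
  forall f : P m -> N, linear f -> (forall x, f (pr_diff P m x) = 0) ->
    is_coboundary f.
Proof.
have pi0 : (\pi_(Ext m) 0 = 0)%qT by rewrite (@pi_zeror _ _ _ _ _ (Ext m)).
split=> [e0 f lf df | b e].
  have cf : f \in is_cocycle m by apply/asboolP.
  suff : Cocycle cf \in coboundary m by move/asboolP.
  by rewrite -[Cocycle cf]subr0 Quotient.idealrBE -/(Ext m) [X in X == _]e0 pi0.
elim/quotW: e => -[f cf].
rewrite -pi0; apply/eqP; rewrite -Quotient.idealrBE subr0; apply/asboolP => /=.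
by move/asboolP: cf => [lf df]; exact: b.
Qed.

End Ext.

Section FreeModule.
Variables (A : nzRingType) (M V : lmodType A) (f : M -> V).

Definition free_cover : lmodType A := {freeg M / A}.

Definition free_gen (x : M) : free_cover := freeg.Freeg [:: (1, x)].

Definition free_lift : free_cover -> V := freeg.fglift f.

Lemma free_lift_is_linear : linear free_lift.
Proof.
pose F : {additive free_cover -> V} :=
  HB.pack free_lift (GRing.isZmodMorphism.Build _ _ free_lift
    (freeg.lift_is_additive f)).
have FU c x : F (freeg.Freeg [:: (c, x)]) = c *: f x := freeg.liftU f c x.
move=> a x y; rewrite -[free_lift]/(F : _ -> _) raddfD; congr (_ + _).
rewrite -{2}[x]freeg.freeg_sumE [a *: x]/(freeg.fgscale a x) /freeg.fgscale.
rewrite !raddf_sum; apply: eq_bigr => z _.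
rewrite FU [RHS]/(a *: F _) FU; exact/esym/scalerA.
Qed.
HB.instance Definition _ := GRing.isLinear.Build A free_cover V _ free_lift
  free_lift_is_linear.

Lemma free_lift_gen x : free_lift (free_gen x) = f x.
Proof. by rewrite /free_lift freeg.liftU scale1r. Qed.

Lemma free_genE (D : free_cover) :
  D = \sum_(x <- freeg.dom D) freeg.coeff x D *: free_gen x.
Proof.
rewrite -[LHS]freeg.freeg_sumE; apply: eq_bigr => x _.
apply/eqP/freeg.freeg_eqP => z.
by rewrite freeg.coeffZ !freeg.coeffU mul1r.
Qed.

End FreeModule.

Lemma free_cover_projective (A : nzRingType) (M : lmodType A) :
  projective (free_cover M).
Proof.
move=> U V g f gsurj.
have [s sK] := boolp.choice gsurj.
exists (free_lift (fun x => s (f (free_gen x)))) => D.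
rewrite [D]free_genE !linear_sum; apply: eq_bigr => x _.
by rewrite !linearZ /= free_lift_gen sK.
Qed.

Section Kernel.
Variables (A : nzRingType) (U V : lmodType A) (f : {linear U -> V}).

Definition in_kernel : {pred U} := [pred x | f x == 0].

Lemma in_kernel_submod_closed : submod_closed in_kernel.
Proof.
split=> [|a x y]; rewrite !inE ?linear0 // => /eqP fx /eqP fy.
by rewrite linearP fx fy scaler0 addr0.
Qed.
HB.instance Definition _ :=
  GRing.isSubmodClosed.Build A U in_kernel in_kernel_submod_closed.

Record kernel := Kernel { kernel_val : U; kernelP : kernel_val \in in_kernel }.
HB.instance Definition _ := [isSub for kernel_val].
HB.instance Definition _ := [Choice of kernel by <:].
HB.instance Definition _ := [SubChoice_isSubLmodule of kernel by <:].

End Kernel.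

Section FreeResolution.
Variables (A : nzRingType) (M : lmodType A).

Fixpoint syzygy (m : nat) : lmodType A :=
  if m is m'.+1 then kernel (free_lift (@id (syzygy m'))) else M.

Definition free_diff m : free_cover (syzygy m.+1) -> free_cover (syzygy m) :=
  (val : syzygy m.+1 -> _) \o free_lift (@id (syzygy m.+1)).
Arguments free_diff m _ : clear implicits.
HB.instance Definition _ m := GRing.Linear.on (free_diff m).

Lemma free_lift_id_surj (V : lmodType A) (v : V) :
  exists x, free_lift id x = v.
Proof. by exists (free_gen v); rewrite free_lift_gen. Qed.

(* Every module has a projective resolution: cover each syzygy by the free module
   on its underlying set. *)
Definition free_resolution : projres M.
Proof.
have ex m (x : free_cover (syzygy m)) :
    free_lift id x = 0 <-> exists y, free_diff m y = x.
  split=> [fx0|[y <-]]; last exact/eqP/(valP (free_lift id y)).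
  have kx : x \in in_kernel (free_lift (@id (syzygy m))) by exact/eqP.
  by have [y yE] := free_lift_id_surj (Kernel kx); exists y; rewrite /free_diff /= yE.
apply: (@ProjRes A M (fun m => free_cover (syzygy m)) free_diff (free_lift id)).
- by move=> m; exact: free_cover_projective.
- move=> m x; rewrite -ex; split=> [dx0|x0].
    by apply: val_inj; exact: dx0.
  by apply: (etrans (congr1 val x0)).
- exact: (ex 0%N).
- exact: free_lift_id_surj.
Defined.
End FreeResolution.

Definition fulltrans (n : nat) := {ffun 'I_n -> 'I_n}.

Section FullTrans.
Variable n : nat.
Local Notation T := (fulltrans n).

HB.instance Definition _ := Finite.on T.

Definition ft_comp (f g : T) : T := [ffun i => f (g i)].
Definition ft_id : T := [ffun i => i].

Lemma ft_compA : associative ft_comp.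
Proof. by move=> f g h; apply/ffunP => i; rewrite !ffunE. Qed.

Lemma ft_comp1f : left_id ft_id ft_comp.
Proof. by move=> f; apply/ffunP => i; rewrite !ffunE. Qed.

Lemma ft_compf1 : right_id ft_id ft_comp.
Proof. by move=> f; apply/ffunP => i; rewrite !ffunE. Qed.

HB.instance Definition _ := isMonoid.Build T ft_compA ft_comp1f ft_compf1.

Definition ft_rank (f : T) : nat := #|[set f i | i : 'I_n]|.

(* {1, ..., n} is shifted to {0, ..., n - 1}: e_r sends the points i >= r to 0. *)
Definition ft_e (r : nat) : T :=
  [ffun i : 'I_n => if (i < r)%N then i else insubd i 0%N].

(* The group of units of the monoid e T e. *)
Definition ft_units (e : T) : {set T} :=
  [set g | (e * g * e == g)%g &&
     [exists h, [&& e * h * e == h, g * h == e & h * g == e]%g]].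

(* The restriction of g to the first r points is the permutation s. *)
Definition ft_restr (r : nat) (g : T) (s : 'S_r) : Prop :=
  forall (i : 'I_n) (j : 'I_r), i = j :> nat -> g i = s j :> nat.

End FullTrans.

(* The monoid algebra of fulltrans n; the alias hides the pointwise product that
   MathComp puts on finite functions. *)
Definition ft_alg (K : comNzRingType) (n : nat) := {ffun fulltrans n -> K^o}.

Section FullTransAlgebra.
Variables (K : comNzRingType) (n : nat).
Local Notation A := (ft_alg K n).
Local Notation T := (fulltrans n).

HB.instance Definition _ := GRing.Lmodule.on A.

Definition ft_delta (f : T) : A := [ffun g => (g == f)%:R].

Definition ft_alg_mul (a b : A) : A :=
  \sum_(f : T) \sum_(g : T) (a f * b g) *: ft_delta (f * g)%g.

Lemma ft_alg_sum (a : A) : a = \sum_(f : T) a f *: ft_delta f.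
Proof.
apply/ffunP => g; rewrite sum_ffunE (bigD1 g) //= big1 => [|f fg].
  by rewrite !ffunE eqxx addr0 [RHS]mulr1.
by rewrite !ffunE eq_sym (negPf fg) scaler0.
Qed.

Lemma ft_alg_mulDl : left_distributive ft_alg_mul +%R.
Proof.
move=> a b c; rewrite /ft_alg_mul -big_split; apply: eq_bigr => f _.
by rewrite -big_split; apply: eq_bigr => g _; rewrite ffunE mulrDl scalerDl.
Qed.

Lemma ft_alg_mulDr : right_distributive ft_alg_mul +%R.
Proof.
move=> a b c; rewrite /ft_alg_mul -big_split; apply: eq_bigr => f _.
by rewrite -big_split; apply: eq_bigr => g _; rewrite ffunE mulrDr scalerDl.
Qed.

Lemma ft_alg_mulZl k a b : ft_alg_mul (k *: a) b = k *: ft_alg_mul a b.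
Proof.
rewrite /ft_alg_mul scaler_sumr; apply: eq_bigr => f _.
rewrite scaler_sumr; apply: eq_bigr => g _.
by rewrite ffunE scalerA mulrA.
Qed.

Lemma ft_alg_mulZr k a b : ft_alg_mul a (k *: b) = k *: ft_alg_mul a b.
Proof.
rewrite /ft_alg_mul scaler_sumr; apply: eq_bigr => f _.
rewrite scaler_sumr; apply: eq_bigr => g _.
by rewrite ffunE scalerA [in RHS]mulrCA.
Qed.

Lemma ft_alg_mul_suml (c : T -> K) (x : T -> A) b :
  ft_alg_mul (\sum_f c f *: x f) b = \sum_f c f *: ft_alg_mul (x f) b.
Proof.
pose m a := ft_alg_mul a b.
have m0 : m 0 = 0 by rewrite -(scale0r (0 : A)) /m ft_alg_mulZl !scale0r.
rewrite -/(m _) (big_morph m (fun x y => ft_alg_mulDl x y b) m0).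
by apply: eq_bigr => f _; rewrite /m ft_alg_mulZl.
Qed.

Lemma ft_alg_mul_sumr (c : T -> K) (x : T -> A) a :
  ft_alg_mul a (\sum_f c f *: x f) = \sum_f c f *: ft_alg_mul a (x f).
Proof.
have m0 : ft_alg_mul a 0 = 0 by rewrite -(scale0r (0 : A)) ft_alg_mulZr !scale0r.
rewrite (big_morph (ft_alg_mul a) (ft_alg_mulDr a) m0).
by apply: eq_bigr => f _; rewrite ft_alg_mulZr.
Qed.

Lemma ft_delta_mul f g :
  ft_alg_mul (ft_delta f) (ft_delta g) = ft_delta (f * g)%g.
Proof.
rewrite /ft_alg_mul (bigD1 f) //= [X in _ + X]big1 => [|f' ff']; last first.
  by rewrite big1 // => g' _; rewrite ffunE (negPf ff') mul0r scale0r.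
rewrite addr0 (bigD1 g) //= big1 => [|g' gg'].
  by rewrite !ffunE !eqxx mulr1 scale1r addr0.
by rewrite !ffunE (negPf gg') mulr0 scale0r.
Qed.

Lemma ft_alg_mulA : associative ft_alg_mul.
Proof.
move=> a b c; rewrite [a]ft_alg_sum !ft_alg_mul_suml; apply: eq_bigr => f _.
congr (_ *: _); rewrite [b]ft_alg_sum !(ft_alg_mul_suml, ft_alg_mul_sumr).
apply: eq_bigr => g _; congr (_ *: _).
rewrite [c]ft_alg_sum !ft_alg_mul_sumr; apply: eq_bigr => h _.
by rewrite !ft_delta_mul mulgA.
Qed.

Lemma ft_alg_mul1x : left_id (ft_delta 1%g) ft_alg_mul.
Proof.
move=> a; rewrite {2}[a]ft_alg_sum {1}[a]ft_alg_sum ft_alg_mul_sumr.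
by apply: eq_bigr => f _; rewrite ft_delta_mul mul1g.
Qed.

Lemma ft_alg_mulx1 : right_id (ft_delta 1%g) ft_alg_mul.
Proof.
move=> a; rewrite {2}[a]ft_alg_sum {1}[a]ft_alg_sum ft_alg_mul_suml.
by apply: eq_bigr => f _; rewrite ft_delta_mul mulg1.
Qed.

Lemma ft_alg1_neq0 : ft_delta 1%g != 0.
Proof.
by apply/eqP => /ffunP/(_ 1%g)/eqP; rewrite !ffunE eqxx oner_eq0.
Qed.

HB.instance Definition _ := GRing.Zmodule_isNzRing.Build A
  ft_alg_mulA ft_alg_mul1x ft_alg_mulx1 ft_alg_mulDl ft_alg_mulDr ft_alg1_neq0.

HB.instance Definition _ := GRing.Lmodule_isLalgebra.Build K A
  (fun k a b => esym (ft_alg_mulZl k a b)).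

HB.instance Definition _ := GRing.Lalgebra_isAlgebra.Build K A
  (fun k a b => esym (ft_alg_mulZr k a b)).

Lemma ft_delta1 : ft_delta 1%g = 1 :> A.
Proof. by []. Qed.

Lemma ft_deltaM f g : ft_delta f * ft_delta g = ft_delta (f * g)%g :> A.
Proof. exact: ft_delta_mul. Qed.

End FullTransAlgebra.

Section Specht.
Variables (K : fieldType) (r : nat).

Definition is_part (lam : seq nat) : bool :=
  [&& sorted geq lam, all (leq 1) lam & sumn lam == r].

(* A tableau is given by the position (row, column) of each entry; rows and
   columns of a Young diagram with r boxes are indexed by 'I_r. *)
Definition tableau := {ffun 'I_r -> 'I_r * 'I_r}.

Definition is_tableau (lam : seq nat) (t : tableau) : bool :=
  injectiveb t && [forall i, (t i).2 < nth 0 lam (t i).1]%N.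

Definition tabloid := {ffun 'I_r -> 'I_r}.

Definition tabloid_of (t : tableau) : tabloid := [ffun i => (t i).1].

(* The entry i of t is replaced by s i. The matching left action on tabloids is an
   action for the composition of functions, whereas the product of 'S_r in MathComp
   is the reversed composition; only single permutations and inverses occur here. *)
Definition perm_tableau (s : 'S_r) (t : tableau) : tableau :=
  [ffun i => t ((s^-1)%g i)].

Definition col_stab (t : tableau) : {set 'S_r} :=
  [set s : 'S_r | [forall i, (t (s i)).2 == (t i).2]].

Definition tabloid_space := {ffun tabloid -> K^o}.

Definition tabloid_delta (T : tabloid) : tabloid_space := [ffun U => (U == T)%:R].

Definition polytabloid (t : tableau) : tabloid_space :=
  \sum_(s in col_stab t)
    (-1) ^+ s *: tabloid_delta (tabloid_of (perm_tableau s t)).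

(* The span of the polytabloids e_t in the permutation module on tabloids. *)
Definition specht (lam : seq nat) : {vspace tabloid_space} :=
  <<[seq polytabloid t | t <- enum (is_tableau lam)]>>%VS.

Definition perm_tabloid (s : 'S_r) (T : tabloid) : tabloid :=
  [ffun i => T ((s^-1)%g i)].

Definition perm_act (s : 'S_r) (v : tabloid_space) : tabloid_space :=
  \sum_T v T *: tabloid_delta (perm_tabloid s T).

End Specht.

Section SimpleModules.
Variables (K : fieldType) (n : nat).

Definition simple_module (A : nzRingType) (M : lmodType A) : Prop :=
  (exists x : M, x != 0) /\
  (forall S : {pred M}, submod_closed S -> S =i pred1 0 \/ S =i predT).

Definition ft_corner (r : nat) (M : lmodType (ft_alg K n)) : set M :=
  [set x | exists y, x = ft_delta K (ft_e n r) *: y].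
Arguments ft_corner r M _ : clear implicits.

(* e_r M is isomorphic to S(lam) as a module over the group algebra of G_{e_r},
   identified with the symmetric group by restriction; the scalar c of K acts on M
   as c%:A. *)
Definition corner_iso_specht (r : nat) (lam : seq nat)
    (M : lmodType (ft_alg K n)) : Prop :=
  exists phi : M -> tabloid_space K r,
    [/\ set_bij (ft_corner r M) [set v | v \in specht K r lam] phi,
        forall c x y, ft_corner r M x -> ft_corner r M y ->
          phi (c%:A *: x + y) = c *: phi x + phi y
      & forall g s x, g \in ft_units (ft_e n r) -> ft_restr g s ->
          ft_corner r M x -> phi (ft_delta K g *: x) = perm_act s (phi x)].

(* M is (a model of) the simple module L(lam), lam a partition of r. *)
Definition is_L (r : nat) (lam : seq nat) (M : lmodType (ft_alg K n)) : Prop :=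
  [/\ simple_module M,
      forall (f : fulltrans n) (x : M), (ft_rank f < r)%N -> ft_delta K f *: x = 0
    & corner_iso_specht r lam M].

End SimpleModules.

(* Main.v *)
Require Import Defs.
From HB Require Import structures.
From mathcomp Require Import all_boot all_order all_algebra.
From mathcomp Require Import zify fingroup perm.
From mathcomp Require Import complex reals boolp.
From mathcomp Require classical_sets.

Set Implicit Arguments.
Unset Strict Implicit.
Unset Printing Implicit Defensive.

Import Order.TTheory GRing.Theory Num.Theory.

Local Open Scope ring_scope.

(* Let A be the algebra of T_n and let D(V) be the A-module with basis the
   injections [r] -> [n] and coefficients in V, where a map kills an injection if
   the composite is not injective.

   If V = e_r L has no nonzero vector on which all transpositions of S_r act by
   -1, then the symmetric part of D(V) is isomorphic to L: an element phi of its
   radical satisfies g phi = 0 for rank g <= r, and for larger ranks one collapses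
   a point b in the image of g onto a point a; this gives
   (g phi)(c f) = - (g phi)(f) for the injection c f obtained from f by replacing
   its value b by a, and three such replacements produce a transposition. Hence L
   is a direct summand of D(V), by averaging over S_r. A Specht module other than
   the sign has no such vector, since every tabloid occurring in it has two entries
   in the same row.

   The module D(V) is graded by maps f, compatibly with composition and with
   trivial action of the stabilizers. If X is such a module, living in ranks < j,
   then the direct sum of A e (x) X_e over the canonical idempotents e (one for
   each kernel) is a projective module of the same kind, and the kernel of its
   projection onto X lives in ranks < j - 1. By dimension shifting
   Ext^m(X, M) = 0 if M is annihilated by rank < k and j <= k + m; here
   j = r + 1. *)

Definition to_linear (A : nzRingType) (U V : lmodType A) (f : U -> V)
    (flin : linear f) : {linear U -> V} :=
  HB.pack f (GRing.isLinear.Build A U V _ f flin).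

(** * Comparison of projective resolutions *)

Section Comparison.
Variables (A : nzRingType).

(** [projective] only lifts along surjections. The kernel of [d] is the fibre product of [U] and [P]
    over [V]; it maps onto [P], and a section of this projection supplies the lift. *)
Lemma projective_lift (P U V : lmodType A) (projP : projective P)
    (g : {linear U -> V}) (f : {linear P -> V}) :
  (forall x, exists u, g u = f x) ->
  exists h : {linear P -> U}, forall x, g (h x) = f x.
Proof.
move=> fg.
pose d (w : U * P) := g w.1 - f w.2.
have dlin : linear d.
  move=> a u v; rewrite /d -[(a *: u + v).1]/(a *: u.1 + v.1).
  rewrite -[(a *: u + v).2]/(a *: u.2 + v.2) (linearP g) (linearP f).
  by rewrite scalerBr opprD addrACA.
pose dL : {linear (U * P)%type -> V} := to_linear dlin.
pose sndL (w : kernel dL) : P := (val w).2.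
have sndlin : linear sndL by [].
pose sndLL : {linear kernel dL -> P} := to_linear sndlin.
have [x|h hE] := projP _ _ sndLL (idfun : {linear P -> P}).
  have [u gu] := fg x.
  have kx : (u, x) \in in_kernel dL by rewrite inE /= /d /= gu subrr.
  by exists (Kernel kx).
pose fh x := (val (h x)).1.
have fhlin : linear fh by move=> a x y; rewrite /fh linearP.
exists (to_linear fhlin) => x /=.
have /eqP := kernelP (h x); rewrite /= /d /fh => /eqP; rewrite subr_eq0 => /eqP ->.
by congr (f _); exact: (hE x).
Qed.

Arguments projective_lift [P U V] projP g f.

(** The criterion of [Ext_eq0P], for every projective resolution at once. *)
Definition ext_vanishes (X M : lmodType A) (m : nat) : Prop :=
  forall (P : projres X) (f : P m -> M),
    linear f -> (forall x, f (pr_diff P m x) = 0) -> is_coboundary f.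

Lemma pr_diffK (X : lmodType A) (P : projres X) m x :
  pr_diff P m (pr_diff P m.+1 x) = 0.
Proof. by apply/pr_exact_diff; exists x. Qed.

Lemma pr_augK (X : lmodType A) (P : projres X) x : pr_aug P (pr_diff P 0%N x) = 0.
Proof. by apply/pr_exact_aug; exists x. Qed.

(** In degree 0 no differential leaves the module, so only the zero map qualifies. *)
Definition factors_diff (X Z : lmodType A) (P : projres X) m :
    (P m -> Z) -> Prop :=
  if m is m'.+1 then fun s => exists h : {linear P m' -> Z},
    forall x, s x = h (pr_diff P m' x)
  else fun s => forall x, s x = 0.

Section Retract.
Variables (X Y : lmodType A) (i : {linear X -> Y}) (p : {linear Y -> X}).
Hypothesis ipK : cancel i p.
Variables (P : projres X) (Q : projres Y).

(* [a] and [b] are the components of chain maps lifting i and p, and [s] is the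
   part h d of a homotopy d h + h d from b a to the identity. *)
Lemma comparison m :
  exists (a : {linear P m -> Q m}) (b : {linear Q m -> P m})
         (s : {linear P m -> P m}),
  [/\ forall x, exists y, pr_diff Q m y = a (pr_diff P m x),
      forall y, exists x, pr_diff P m x = b (pr_diff Q m y),
      forall x, exists y, pr_diff P m y = x - b (a x) - s x,
      factors_diff s
    & forall (Z : lmodType A) (g : {linear Q m -> Z}),
        factors_diff g -> factors_diff (g \o a)].
Proof.
elim: m => [|m [a [b [s [aP bP sP sd agd]]]]].
  have [x|a aE] := projective_lift (@pr_projective _ _ P 0%N) (pr_aug Q)
    (i \o pr_aug P).
    exact: pr_aug_surj.
  have [x|b bE] := projective_lift (@pr_projective _ _ Q 0%N) (pr_aug P)
    (p \o pr_aug Q).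
    exact: pr_aug_surj.
  exists a, b, \0; split=> //= x.
  - by apply/pr_exact_aug; rewrite aE /= pr_augK linear0.
  - by apply/pr_exact_aug; rewrite bE /= pr_augK linear0.
  - by apply/pr_exact_aug; rewrite subr0 linearB bE /= aE /= ipK subrr.
have [x|a' a'E] := projective_lift (@pr_projective _ _ P m.+1) (pr_diff Q m)
  (a \o pr_diff P m); first exact: aP.
have [x|b' b'E] := projective_lift (@pr_projective _ _ Q m.+1) (pr_diff P m)
  (b \o pr_diff Q m); first exact: bP.
(* By [sP], [id - b a - s] takes values in the image of the differential, so it lifts to the next
   piece [h] of the homotopy. *)
have [x|h hE] := projective_lift (@pr_projective _ _ P m) (pr_diff P m)
  ((idfun \- (b \o a)) \- s); first exact: sP.
(* Applying the differential to [id - b' a' - h d] leaves [s d], which vanishes because [s] factors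
   through [d]. *)
have sd0 x : s (pr_diff P m x) = 0.
  case: m a b s sd {aP bP sP agd a' a'E b' b'E h hE} x => [|m] a b s /= sd x.
    exact: sd.
  by have [h hE] := sd; rewrite hE pr_diffK linear0.
exists a', b', (h \o pr_diff P m); split=> [x|x|x||Z g [g' gE]] /=.
- by apply/pr_exact_diff; rewrite a'E /= pr_diffK linear0.
- by apply/pr_exact_diff; rewrite b'E /= pr_diffK linear0.
- apply/pr_exact_diff; rewrite !linearB b'E /= a'E hE /= sd0 subr0.
  by rewrite subrr.
- by exists h.
- by exists (g' \o a) => x /=; rewrite gE a'E.
Qed.

(** A cocycle [f] kills boundaries, so [f = f b a + f s]. Here [f b] is a cocycle on [Q], hence a
    coboundary, and stays one after composition with [a]; [f s] factors through the differential. *)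
Lemma ext_vanishes_retract (M : lmodType A) m :
  (forall f : Q m -> M, linear f -> (forall x, f (pr_diff Q m x) = 0) ->
     is_coboundary f) ->
  forall f : P m -> M, linear f -> (forall x, f (pr_diff P m x) = 0) ->
    is_coboundary f.
Proof.
move=> vQ f0 flin f0d.
pose f : {linear P m -> M} := to_linear flin.
have fd : forall x, f (pr_diff P m x) = 0 by [].
rewrite -[f0]/(f : _ -> _); move: f fd => {flin f0d} f fd {f0}.
have [a [b [s [aP bP sP sd agd]]]] := comparison m.
have fE x : f x = f (b (a x)) + f (s x).
  have [y yE] := sP x; apply/eqP; rewrite -subr_eq0 opprD addrA -!linearB.
  by rewrite -yE fd.
have fb : is_coboundary (f \o b : Q m -> M).
  apply: vQ => [c x y|y]; first by rewrite linearP.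
  by have [x xE] := bP y; rewrite /= -xE fd.
case: m f fd a b s fE fb sd agd {aP bP sP vQ} => [|m] f fd a b s fE fb sd agd /=.
  apply/funext => x; rewrite fE sd linear0 addr0.
  exact: (congr1 (@^~ (a x)) fb).
have [g gE] := agd _ (f \o b) fb; have [h hE] := sd.
exists (g \+ (f \o h)) => x; rewrite fE hE /=.
by congr (_ + _); exact: gE.
Qed.

End Retract.

(** * Dimension shifting *)

Section Splice.
Variables (X Q : lmodType A) (pi : {linear Q -> X}).
Hypothesis projQ : projective Q.
Hypothesis pi_surj : forall x, exists q, pi q = x.

Section Resolution.
Variable F : projres (kernel pi).

Definition splice_obj m : lmodType A := if m is m'.+1 then F m' else Q.

Lemma kernel_val_linear : linear (val : kernel pi -> Q).
Proof. by []. Qed.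

Definition kernel_incl : {linear kernel pi -> Q} := to_linear kernel_val_linear.

Definition splice_diff m : {linear splice_obj m.+1 -> splice_obj m} :=
  if m is m'.+1 then pr_diff F m' else kernel_incl \o pr_aug F.

Definition splice : projres X.
Proof.
apply: (@ProjRes A X splice_obj splice_diff pi) => //.
- by case=> [|m] //=; exact: pr_projective.
- case=> [|m] x; last exact: pr_exact_diff.
  by rewrite -pr_exact_aug /=; split=> [x0|->]; [exact: val_inj|].
- move=> x; split=> [x0|[y <-]]; last exact/eqP/(valP (pr_aug F y)).
  have kx : x \in in_kernel pi by exact/eqP.
  by have [y yE] := pr_aug_surj F (Kernel kx); exists y; rewrite /= yE.
Defined.
End Resolution.

(** The spliced resolution is a resolution of the kernel moved up by one degree. The retract lemma
    with identity maps carries the vanishing over to an arbitrary resolution [P] of [X]. *)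
Lemma ext_vanishes_syzygy (M : lmodType A) m :
  ext_vanishes (kernel pi) M m -> ext_vanishes X M m.+1.
Proof.
move=> vK P; pose F := free_resolution (kernel pi).
apply: (@ext_vanishes_retract X X idfun idfun (fun=> erefl) P (splice F)).
move=> f flin fd; have {fd} := vK F f flin fd.
(* In degree 1 the cochain itself is zero, since 0 is the only coboundary in degree 0 of [F]. *)
case: m f flin {vK} => [|m] f flin //= f0.
by exists \0 => x; rewrite f0.
Qed.

Lemma ext0_vanishes_cover (M : lmodType A) :
  (forall (f : {linear Q -> M}) x, f x = 0) -> ext_vanishes X M 0%N.
Proof.
move=> homQ P; pose F := free_resolution (kernel pi).
apply: (@ext_vanishes_retract X X idfun idfun (fun=> erefl) P (splice F)).
move=> f flin _; apply/funext => x.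
exact: (homQ (to_linear (flin : linear (f : Q -> M)))).
Qed.

End Splice.
End Comparison.

(** * Modules over the monoid algebra, described by the action of single maps *)

Section AlgebraAction.
Variables (K : comNzRingType) (n : nat).
Local Notation A := (ft_alg K n).
Local Notation T := (fulltrans n).

Lemma ft_mulE (f g : T) i : (f * g)%g i = f (g i).
Proof. exact: ffunE. Qed.

Lemma ft_delta_scaleM (X : lmodType A) (f g : T) (x : X) :
  ft_delta K f *: (ft_delta K g *: x) = ft_delta K (f * g)%g *: x.
Proof. by rewrite scalerA ft_deltaM. Qed.

Lemma ft_delta_scale1 (X : lmodType A) (x : X) : ft_delta K 1%g *: x = x.
Proof. exact: scale1r. Qed.

Lemma ft_delta_scaleC (X : lmodType A) (f : T) c (x : X) :
  ft_delta K f *: (c%:A *: x) = c%:A *: (ft_delta K f *: x).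
Proof. by rewrite !scalerA mulr_algl mulr_algr. Qed.

Lemma ft_alg_scaleE (X : lmodType A) (a : A) (x : X) :
  a *: x = \sum_(f : T) (a f : K)%:A *: (ft_delta K f *: x).
Proof.
rewrite {1}[a]ft_alg_sum scaler_suml; apply: eq_bigr => f _.
by rewrite scalerA mulr_algl.
Qed.

Lemma scale_algA (X : lmodType A) (c d : K) (x : X) :
  c%:A *: (d%:A *: x) = (c * d)%:A *: x.
Proof. by rewrite scalerA mulr_algl scalerA. Qed.

Lemma scale_algD (X : lmodType A) (c d : K) (x : X) :
  (c + d)%:A *: x = c%:A *: x + d%:A *: x.
Proof. by rewrite scalerDl scalerDl. Qed.

Lemma scale_alg0 (X : lmodType A) (x : X) : (0 : K)%:A *: x = 0.
Proof. by rewrite scale0r scale0r. Qed.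

Lemma scale_alg1 (X : lmodType A) (x : X) : (1 : K)%:A *: x = x.
Proof. by rewrite scale1r scale1r. Qed.

(** The field acts on an [A]-module through the scalars [c%:A], so linearity over [K] is stated with
    them. *)
Definition klinear (X Y : lmodType A) (f : X -> Y) : Prop :=
  forall c x y, f (c%:A *: x + y) = c%:A *: f x + f y.

Section KLinear.
Variables (X Y : lmodType A) (f : X -> Y).
Hypothesis fK : klinear f.

Lemma klinearD x y : f (x + y) = f x + f y.
Proof. by have := fK 1 x y; rewrite !scale_alg1. Qed.

Lemma klinear0 : f 0 = 0.
Proof. by apply: (addrI (f 0)); rewrite -klinearD !addr0. Qed.

Lemma klinearZ c x : f (c%:A *: x) = c%:A *: f x.
Proof. by have := fK c x 0; rewrite klinear0 !addr0. Qed.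

Lemma klinear_sum (I : Type) (r : seq I) (P : pred I) (F : I -> X) :
  f (\sum_(i <- r | P i) F i) = \sum_(i <- r | P i) f (F i).
Proof. exact: (big_morph f klinearD klinear0). Qed.

Lemma klinear_linear :
  (forall g x, f (ft_delta K g *: x) = ft_delta K g *: f x) -> linear f.
Proof.
move=> fg a x y; rewrite klinearD; congr (_ + _).
rewrite !(ft_alg_scaleE a) klinear_sum; apply: eq_bigr => h _.
by rewrite klinearZ fg.
Qed.
End KLinear.

Lemma ft_submod_closed (X : lmodType A) (S : {pred X}) :
  0 \in S -> (forall x y, x \in S -> y \in S -> x + y \in S) ->
  (forall c x, x \in S -> c%:A *: x \in S) ->
  (forall g x, x \in S -> ft_delta K g *: x \in S) -> submod_closed S.
Proof.
move=> S0 SD SZ Sg; split=> // a x y Sx Sy.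
have SaD := SD _ y; apply: SaD => //.
rewrite ft_alg_scaleE; apply: (big_ind (fun z => z \in S)) => // f _.
by apply: SZ; exact: Sg.
Qed.

End AlgebraAction.

(** * Modules of functions on the monoid *)

Section FunctionModule.
Variables (K : comNzRingType) (n : nat).
Local Notation A := (ft_alg K n).
Local Notation T := (fulltrans n).

Definition ft_keeps (gr : bool) (g f : T) : bool :=
  gr ==> (ft_rank (g * f)%g == ft_rank f).

Lemma ft_rank_mull (g f : T) : (ft_rank (g * f)%g <= ft_rank g)%N.
Proof.
apply/subset_leq_card/subsetP => _ /imsetP[i _ ->].
by rewrite ft_mulE imset_f.
Qed.

Lemma ft_imsetM (g f : T) :
  [set (g * f)%g i | i : 'I_n] = [set g i | i in [set f i | i : 'I_n]].
Proof. by rewrite -imset_comp; apply: eq_imset => i; rewrite ft_mulE. Qed.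

Lemma ft_rank_mulr (g f : T) : (ft_rank (g * f)%g <= ft_rank f)%N.
Proof.
by rewrite /ft_rank ft_imsetM leq_imset_card.
Qed.

(** Rank can only drop along [f], [h * f], [g * h * f], so it is kept overall exactly when it is
    kept at both steps. This makes the truncated action associative. *)
Lemma ft_keepsM gr (g h f : T) :
  ft_keeps gr (g * h)%g f = ft_keeps gr h f && ft_keeps gr g (h * f)%g.
Proof.
case: gr => //=; rewrite -mulgA.
have := ft_rank_mulr g (h * f)%g; have := ft_rank_mulr h f.
move: (ft_rank _) (ft_rank _) (ft_rank _) => a b c ba ab.
by apply/idP/idP; lia.
Qed.

(* The tensor product of W over K with the module with basis T; for gr = true the
   action is the one on the associated graded module of the filtration by rank. *)
Definition funmod (gr : bool) (W : lmodType A) := {ffun T -> W}.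

Variables (gr : bool) (W : lmodType A).
Local Notation B := (funmod gr W).

HB.instance Definition _ := GRing.Zmodule.on B.

Definition fm_act (g : T) (q : B) : B :=
  [ffun h => \sum_(f | (g * f == h)%g && ft_keeps gr g f) q f].

Definition fm_scale (a : A) (q : B) : B :=
  [ffun h => \sum_(g : T) (a g : K)%:A *: fm_act g q h].

Lemma fm_act1 q : fm_act 1%g q = q.
Proof.
apply/ffunP => h; rewrite ffunE (big_pred1 h) // => f.
rewrite mul1g /ft_keeps mul1g eqxx; case: gr => /=; by rewrite andbT.
Qed.

Lemma fm_actM g h q : fm_act (g * h)%g q = fm_act g (fm_act h q).
Proof.
apply/ffunP => k; rewrite !ffunE.
under [RHS]eq_bigr do rewrite ffunE.
rewrite [RHS](exchange_big_dep predT) //= big_mkcond; apply: eq_bigr => f _.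
rewrite ft_keepsM; case: ifPn => [/and3P[/eqP ghf hf gh]|].
  rewrite (big_pred1 (h * f)%g) // => l /=.
  rewrite hf andbT [(_ == l)]eq_sym.
  case: (l =P (h * f)%g) => [->|_]; last by rewrite andbF.
  by rewrite mulgA ghf eqxx gh.
move=> nk; rewrite big_pred0 // => l; apply/negP => /andP[/andP[gl kl] /andP[/eqP hl kh]].
move: nk gl kl; rewrite -hl => /negP nk gl kl; apply: nk.
by rewrite -mulgA gl kh kl.
Qed.

Lemma fm_scaleA a b q : fm_scale a (fm_scale b q) = fm_scale (a * b) q.
Proof.
apply/ffunP => k; rewrite !ffunE.
pose S := \sum_g \sum_h (a g * b h : K)%:A *: fm_act (g * h)%g q k.
transitivity S.
  apply: eq_bigr => g _; rewrite ffunE.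
  under eq_bigr do rewrite ffunE.
  rewrite exchange_big scaler_sumr; apply: eq_bigr => h _ /=.
  by rewrite -scaler_sumr scale_algA fm_actM ffunE.
pose F (c : A) := \sum_g (c g : K)%:A *: fm_act g q k.
have FD c d : F (c + d) = F c + F d.
  by rewrite /F -big_split; apply: eq_bigr => g _; rewrite ffunE scale_algD.
have F0 : F 0 = 0 by rewrite /F big1 // => g _; rewrite ffunE scale_alg0.
rewrite -[RHS]/(F _) {}/S -[a * b]/(ft_alg_mul a b) /ft_alg_mul.
rewrite (big_morph F FD F0); apply: eq_bigr => g _.
rewrite (big_morph F FD F0); apply: eq_bigr => h _.
rewrite /F (bigD1 (g * h)%g) //= big1 => [|l gl].
  rewrite addr0; congr (_ *: 1 *: _); rewrite !ffunE eqxx.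
  exact/esym/mulr1.
by rewrite ffunE [ft_delta _ _ _]ffunE (negPf gl) scaler0 scale_alg0.
Qed.

Lemma fm_scaleDelta g q : fm_scale (ft_delta K g) q = fm_act g q.
Proof.
apply/ffunP => k; rewrite ffunE (bigD1 g) //= big1 => [|l gl].
  by rewrite addr0 !ffunE eqxx scale_alg1.
by rewrite ffunE (negPf gl) scale_alg0.
Qed.

Lemma fm_scale1 q : fm_scale 1 q = q.
Proof. by rewrite -[1]/(ft_delta K 1%g) fm_scaleDelta fm_act1. Qed.

Lemma fm_scaleDr a : {morph fm_scale a : p q / p + q}.
Proof.
move=> p q; apply/ffunP => k; rewrite !ffunE -big_split; apply: eq_bigr => g _.
rewrite /= -scalerDr; congr (_ *: _); rewrite !ffunE -big_split.
by apply: eq_bigr => f _; rewrite ffunE.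
Qed.

Lemma fm_scaleDl q : {morph fm_scale^~ q : a b / a + b}.
Proof.
move=> a b; apply/ffunP => k; rewrite !ffunE -big_split; apply: eq_bigr => g _.
by rewrite ffunE scale_algD.
Qed.

HB.instance Definition _ := GRing.Zmodule_isLmodule.Build A B
  fm_scaleA fm_scale1 fm_scaleDr fm_scaleDl.

Lemma funmod_deltaE g (q : B) h :
  (ft_delta K g *: q) h = \sum_(f | (g * f == h)%g && ft_keeps gr g f) q f.
Proof. by rewrite -[_ *: q]/(fm_scale _ q) fm_scaleDelta ffunE. Qed.

Lemma funmod_algE c (q : B) h : (c%:A *: q) h = c%:A *: q h.
Proof.
rewrite -[_ *: q]/(fm_scale _ q) ffunE (bigD1 (1%g : T)) //= big1 => [|g g1].
  rewrite addr0 fm_act1; congr (_ *: 1 *: _); rewrite !ffunE eqxx.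
  exact: mulr1.
by rewrite ffunE [(1 : A) g]ffunE (negPf g1) scaler0 scale_alg0.
Qed.

Lemma funmodD (p q : B) h : (p + q) h = p h + q h.
Proof. exact: ffunE. Qed.

Lemma funmod0 h : (0 : B) h = 0.
Proof. exact: ffunE. Qed.

End FunctionModule.

Section Submodule.
Variables (A : nzRingType) (X : lmodType A) (p : {pred X}).

(** The closure proof is an argument so that the structure of a submodule can be attached to the
    predicate. *)
Definition submod_pred of submod_closed p : {pred X} := p.

Variable p_closed : submod_closed p.

HB.instance Definition _ :=
  GRing.isSubmodClosed.Build A X (submod_pred p_closed) p_closed.

Record submodule := Submodule {
  submodule_val : X;
  submoduleP : submodule_val \in submod_pred p_closed
}.
HB.instance Definition _ := [isSub for submodule_val].
HB.instance Definition _ := [Choice of submodule by <:].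
HB.instance Definition _ := [SubChoice_isSubLmodule of submodule by <:].
End Submodule.

(** * Finite dimension, lifts over the field, and a projectivity criterion *)

Section FiniteDimension.
Variables (K : fieldType) (n : nat).
Local Notation A := (ft_alg K n).
Local Notation T := (fulltrans n).

(** [X] carries no vector space structure over [K] of its own, so finiteness is expressed by an
    embedding. *)
Definition fin_dim (X : lmodType A) : Prop :=
  exists (W : vectType K) (phi : X -> W), injective phi /\
    forall c x y, phi (c%:A *: x + y) = c *: phi x + phi y.

Lemma fin_dim_sub (X Y : lmodType A) (i : X -> Y) :
  injective i -> klinear i -> fin_dim Y -> fin_dim X.
Proof.
move=> iI iK [W [phi [phiI phiK]]]; exists W, (phi \o i); split.
  exact: inj_comp.
by move=> c x y; rewrite /= iK phiK.
Qed.

Lemma fin_dim_ffun (I : finType) (X : lmodType A) : fin_dim X ->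
  fin_dim {ffun I -> X}.
Proof.
move=> [W [phi [phiI phiK]]].
exists {ffun I -> W}, (fun q : {ffun I -> X} => [ffun i => phi (q i)]); split.
  by move=> p q /ffunP pq; apply/ffunP => i; apply: phiI; have := pq i; rewrite !ffunE.
by move=> c p q; apply/ffunP => i; rewrite !ffunE phiK.
Qed.

Lemma fin_dim_funmod gr (X : lmodType A) : fin_dim X -> fin_dim (funmod gr X).
Proof.
move=> fX; apply: (@fin_dim_sub (funmod gr X) {ffun T -> X} (fun q => q)).
- by [].
- move=> c p q; apply/ffunP => h.
  by rewrite funmodD funmod_algE !ffunE.
- exact: fin_dim_ffun.
Qed.

Lemma fin_dim_lift (X U V : lmodType A) (F : X -> V) (g : {linear U -> V}) :
  fin_dim X -> klinear F -> (forall v, exists u, g u = v) ->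
  exists s : X -> U, klinear s /\ forall x, g (s x) = F x.
Proof.
move=> [W [phi [phiI phiK]]] FK gsurj.
have phiD x y : phi (x + y) = phi x + phi y.
  by have := phiK 1 x y; rewrite scale_alg1 scale1r.
have phi0 : phi 0 = 0 by apply: (addrI (phi 0)); rewrite -phiD !addr0.
have phiZ c x : phi (c%:A *: x) = c *: phi x.
  by have := phiK c x 0; rewrite phi0 !addr0.
(* A finite list whose image has a span of maximal dimension generates the whole image of [phi]:
   adding one more element cannot enlarge the span. *)
pose P d := `[< exists xs : seq X, \dim <<map phi xs>>%VS = d >].
have exP : exists d, P d by exists (\dim <<map phi [::]>>%VS); apply/asboolP; exists [::].
have bP d : P d -> (d <= \dim {:W})%N.
  by move=> /asboolP[xs <-]; exact/dimvS/subvf.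
have [d /asboolP[xs xsd] dmax] := ex_maxnP exP bP.
have span x : phi x \in <<map phi xs>>%VS.
  have sub : (<<map phi xs>> <= <<map phi (x :: xs)>>)%VS.
    by rewrite /= span_cons addvSr.
  have : (\dim <<map phi (x :: xs)>>%VS <= \dim <<map phi xs>>%VS)%N.
    by rewrite xsd; apply: dmax; apply/asboolP; exists (x :: xs).
  rewrite (geq_leqif (dimv_leqif_eq sub)) => /eqP ->.
  by rewrite memv_span // mem_head.
have [t tE] := choice (fun x => gsurj (F x)).
pose ps := map_tuple phi (in_tuple xs).
(* The list may be linearly dependent; [coord] still makes a linear choice of coefficients. *)
pose co i x : K := coord ps i (phi x).
exists (fun x => \sum_i (co i x)%:A *: t (xs`_i)); split=> [c x y|x].
  rewrite scaler_sumr -big_split; apply: eq_bigr => i _ /=.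
  by rewrite /co phiK linearP scale_algD scale_algA.
rewrite linear_sum; under eq_bigr do rewrite linearZ /= tE -(klinearZ FK).
rewrite -(klinear_sum FK); congr F; apply: phiI.
rewrite (big_morph phi phiD phi0) [RHS](coord_span (span x : phi x \in <<ps>>%VS)).
apply: eq_bigr => i _; rewrite phiZ; congr (_ *: _).
by rewrite -(nth_map _ 0).
Qed.

(* The maps [c f] split the surjection from the tensor product over K of the
   algebra with Q onto Q. *)
Lemma projective_coords (Q : lmodType A) (c : T -> Q -> Q) :
  fin_dim Q -> (forall f, klinear (c f)) ->
  (forall g q h, c h (ft_delta K g *: q) = \sum_(f | (g * f == h)%g) c f q) ->
  (forall q, \sum_f ft_delta K f *: c f q = q) -> projective Q.
Proof.
move=> fQ cK cg csum U V g F gsurj.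
have [s [sK sE]] := fin_dim_lift fQ (fun a x y => linearP F a%:A x y) gsurj.
(* The lift [s] is only [K]-linear. Splitting [q] into its coordinates and lifting these makes it
   commute with the monoid, by [cg]. *)
pose h q := \sum_f ft_delta K f *: s (c f q).
have hK : klinear h.
  move=> a x y; rewrite scaler_sumr -big_split; apply: eq_bigr => f _ /=.
  by rewrite cK sK scalerDr ft_delta_scaleC.
have hg k q : h (ft_delta K k *: q) = ft_delta K k *: h q.
  rewrite /h scaler_sumr.
  under eq_bigr do rewrite cg (klinear_sum sK) scaler_sumr.
  rewrite (exchange_big_dep predT) //=; apply: eq_bigr => f _.
  rewrite ft_delta_scaleM (big_pred1 (k * f)%g) //.
exists (to_linear (klinear_linear hK hg)) => q /=.
rewrite -[in RHS](csum q) /h !linear_sum; apply: eq_bigr => f _.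
by rewrite !linearZ /= sE.
Qed.
End FiniteDimension.

(** * Canonical idempotents attached to kernels of maps *)

Section KernelRepresentative.
Variable n : nat.
Local Notation T := (fulltrans n).

(** Sends a point to the chosen representative of its fibre under [f]; the default is never reached,
    as [i] lies in that fibre. [pick] depends only on the fibre, so maps with equal kernels share
    this idempotent. *)
Definition ft_ker (f : T) : T := [ffun i => odflt i [pick j | f j == f i]].

Lemma ft_kerE (f : T) i : f (ft_ker f i) = f i.
Proof. by rewrite ffunE; case: pickP => [j /eqP|]. Qed.

Lemma ft_mul_ker (f : T) : (f * ft_ker f)%g = f.
Proof. by apply/ffunP => i; rewrite ft_mulE ft_kerE. Qed.

Lemma eq_ft_ker (f g : T) : (forall i j, (f i == f j) = (g i == g j)) ->
  ft_ker f = ft_ker g.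
Proof.
move=> fg; apply/ffunP => i; rewrite !ffunE (eq_pick (fun j => fg j i)).
by case: pickP => [//|/(_ i)]; rewrite eqxx.
Qed.

Lemma ft_ker_eq (f : T) i j : (ft_ker f i == ft_ker f j) = (f i == f j).
Proof.
apply/eqP/eqP => [E|E]; first by rewrite -(ft_kerE f i) E ft_kerE.
rewrite !ffunE E; case: pickP => [//|/(_ j)]; by rewrite eqxx.
Qed.

Lemma ft_kerK (f : T) : ft_ker (ft_ker f) = ft_ker f.
Proof. by apply: eq_ft_ker => i j; rewrite ft_ker_eq. Qed.

Lemma ft_ker_idem (e : T) : ft_ker e = e -> (e * e)%g = e.
Proof. by move=> ek; rewrite -{2}ek ft_mul_ker. Qed.

Lemma ft_rank_mul_inj (g f : T) : ft_rank (g * f)%g = ft_rank f ->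
  forall i j, g (f i) = g (f j) -> f i = f j.
Proof.
rewrite /ft_rank ft_imsetM.
by move=> /eqP/imset_injP gI i j; apply: gI; exact: imset_f.
Qed.

Lemma ft_left_factor (f e : T) : (forall i j, f i = f j -> e i = e j) ->
  exists h : T, (h * f)%g = e.
Proof.
move=> fe; exists [ffun x => odflt x (omap e [pick i | f i == x])].
apply/ffunP => i; rewrite ft_mulE ffunE.
case: pickP => [j /eqP /fe //|/(_ i)]; by rewrite eqxx.
Qed.

End KernelRepresentative.

(** * Graded modules, graded projectives onto them, and their syzygies *)

Section Grading.
Variables (K : fieldType) (n : nat).
Local Notation A := (ft_alg K n).
Local Notation T := (fulltrans n).

(* The p f are the projections of a decomposition X = \bigoplus_f X_f, with
   X_f = 0 unless f has rank < j. *)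
Record grading (j : nat) (X : lmodType A) (p : T -> X -> X) : Prop := Grading {
  gr_klinear : forall f, klinear (p f);
  gr_sum : forall x, \sum_f p f x = x;
  gr_orth : forall f g x, p f (p g x) = if f == g then p g x else 0;
  gr_act : forall g f x, p (g * f)%g (ft_delta K g *: p f x) = ft_delta K g *: p f x;
  gr_fix : forall g f x, (g * f)%g = f -> ft_delta K g *: p f x = p f x;
  gr_supp : forall f x, (j <= ft_rank f)%N -> p f x = 0
}.

Lemma ft_section (f : T) : exists h : T, (h * f = ft_ker f)%g.
Proof. by apply: ft_left_factor => i j /eqP; rewrite -ft_ker_eq => /eqP. Qed.

(** With [h] a section of [f], the map [f * h] stabilizes [f], so it acts trivially on the component
    at [f]; having rank less than [k], it also kills [M]. *)
Lemma grading_hom0 (k j : nat) (X M : lmodType A) (p : T -> X -> X) :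
  grading j p -> (j <= k)%N ->
  (forall f (x : M), (ft_rank f < k)%N -> ft_delta K f *: x = 0) ->
  forall (u : {linear X -> M}) x, u x = 0.
Proof.
move=> gp jk Mk u x; rewrite -(gr_sum gp x) linear_sum big1 // => f _.
have [fj|fj] := leqP j (ft_rank f); first by rewrite (gr_supp gp) // linear0.
have [h hf] := ft_section f.
rewrite -(gr_fix gp (g := (f * h)%g)) -?mulgA ?hf ?ft_mul_ker //.
rewrite linearZ /= Mk //; apply: leq_ltn_trans (ft_rank_mull _ _) _.
exact: leq_trans jk.
Qed.

Section Cover.
Variables (j : nat) (X : lmodType A) (p : T -> X -> X).
Hypothesis gp : grading j p.

Lemma gr_actE g f x y : p f y = y -> p x (ft_delta K g *: y) =
  if (x == g * f)%g then ft_delta K g *: y else 0.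
Proof. by move=> <-; rewrite -{1}(gr_act gp) (gr_orth gp) (gr_act gp). Qed.

(** The direct sum of the [A e (x) X_e] over canonical idempotents [e]: [q f e] in [X_e] is the
    coefficient at the basis element [f = f e] of [A e]. *)
Definition is_cover : {pred funmod false {ffun T -> X}} :=
  [pred q : funmod false {ffun T -> X} | `[< forall f e, p e (q f e) = q f e /\
    (~~ ((f * e == f)%g && (ft_ker e == e)) -> q f e = 0) >]].

Lemma is_cover_closed : submod_closed is_cover.
Proof.
apply: ft_submod_closed => [|q r /asboolP Cq /asboolP Cr|c q /asboolP Cq|g q /asboolP Cq];
  apply/asboolP => f e.
- by rewrite funmod0 ffunE (klinear0 (gr_klinear gp e)).
- have [pq q0] := Cq f e; have [pr r0] := Cr f e.
  rewrite funmodD ffunE (klinearD (gr_klinear gp e)) pq pr; split=> // fe.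
  by rewrite q0 ?r0 ?addr0.
- have [pq q0] := Cq f e.
  rewrite funmod_algE ffunE (klinearZ (gr_klinear gp e)) pq; split=> // fe.
  by rewrite q0 ?scaler0.
- rewrite funmod_deltaE sum_ffunE (klinear_sum (gr_klinear gp e)); split.
    by apply: eq_bigr => h _; case: (Cq h e).
  move=> fe; apply: big1 => h /andP[/eqP gh _]; have [_] := Cq h e; apply.
  apply: contra fe => /andP[/eqP he ->]; rewrite -gh -mulgA he eqxx; done.
Qed.

Definition cover : lmodType A := submodule is_cover_closed.

Lemma cover_grE (q : cover) f e : p e (val q f e) = val q f e.
Proof. by have /asboolP/(_ f e)[] := submoduleP q. Qed.

Lemma cover_eq0 (q : cover) f e :
  ~~ ((f * e == f)%g && (ft_ker e == e)) -> val q f e = 0.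
Proof. by have /asboolP/(_ f e)[] := submoduleP q. Qed.

Lemma cover_mulE (q : cover) f e : val q f e <> 0 -> (f * e)%g = f.
Proof.
move=> qfe; apply/eqP; apply: contra_notT qfe => fe.
by apply: cover_eq0; rewrite negb_and fe.
Qed.

Definition cover_map (q : cover) : X := \sum_f \sum_e ft_delta K f *: val q f e.

Lemma cover_map_linear : linear cover_map.
Proof.
apply: klinear_linear => [c q r|g q].
  rewrite /cover_map scaler_sumr -big_split; apply: eq_bigr => f _ /=.
  rewrite scaler_sumr -big_split; apply: eq_bigr => e _ /=.
  by rewrite funmodD funmod_algE !ffunE scalerDr ft_delta_scaleC.
rewrite /cover_map exchange_big [in RHS]exchange_big scaler_sumr.
apply: eq_bigr => e _ /=; rewrite scaler_sumr.
under eq_bigr do rewrite [val _]/= funmod_deltaE sum_ffunE scaler_sumr.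
rewrite (exchange_big_dep predT) //=; apply: eq_bigr => f _.
rewrite ft_delta_scaleM (big_pred1 (g * f)%g) // => h.
by rewrite andbT eq_sym.
Qed.

Definition cover_lin : {linear cover -> X} := to_linear cover_map_linear.

(** If [s f * f = ft_ker f], then [s f] carries [X_f] into the component of the idempotent
    [ft_ker f], and [f] carries it back, because [f * s f] acts trivially on [X_f]. *)
Lemma cover_surj x : exists q, cover_lin q = x.
Proof.
have [s sE] := choice ft_section.
pose q : funmod false {ffun T -> X} :=
  [ffun f => [ffun e => if e == ft_ker f then ft_delta K (s f) *: p f x else 0]].
have Cq : q \in submod_pred is_cover_closed.
  apply/asboolP => f e; rewrite !ffunE.
  case: (e =P ft_ker f) => [->|_]; last by rewrite (klinear0 (gr_klinear gp e)).
  by rewrite ft_mul_ker ft_kerK !eqxx -{1}sE (gr_act gp).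
exists (Submodule Cq); rewrite /= /cover_map -[RHS](gr_sum gp).
apply: eq_bigr => f _; rewrite (bigD1 (ft_ker f)) //= big1 => [|e ef].
  rewrite !ffunE eqxx addr0 ft_delta_scaleM (gr_fix gp) //.
  by rewrite -mulgA sE ft_mul_ker.
by rewrite !ffunE (negPf ef) scaler0.
Qed.

(** Since f (x) x = f (e (x) x), the coordinate at [f] moves each coefficient [q f e] to the
    generator [e] of [A e]. *)
Definition cover_coord_fun (f : T) (q : cover) : funmod false {ffun T -> X} :=
  [ffun h => [ffun e => if h == e then val q f e else 0]].

Lemma cover_coord_subproof f q :
  cover_coord_fun f q \in submod_pred is_cover_closed.
Proof.
apply/asboolP => h e; rewrite !ffunE; case: eqP => [->|_]; last first.
  by rewrite (klinear0 (gr_klinear gp e)).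
rewrite cover_grE; split=> // ee; apply: cover_eq0; apply: contra ee.
by move=> /andP[_ ke]; rewrite ke andbT (ft_ker_idem (eqP ke)).
Qed.

Definition cover_coord f q : cover := Submodule (cover_coord_subproof f q).

Lemma cover_coordE f q h e :
  val (cover_coord f q) h e = if h == e then val q f e else 0.
Proof. by rewrite !ffunE. Qed.

Lemma coverP (q r : cover) : (forall f e, val q f e = val r f e) -> q = r.
Proof.
by move=> qr; apply/val_inj/ffunP => f; apply/ffunP => e; exact: qr.
Qed.

Lemma cover_valD (q r : cover) f e : val (q + r) f e = val q f e + val r f e.
Proof. by rewrite /= funmodD ffunE. Qed.

Lemma cover_valZ c (q : cover) f e : val (c%:A *: q) f e = c%:A *: val q f e.
Proof. by rewrite /= funmod_algE ffunE. Qed.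

Lemma cover_val_delta g (q : cover) f e :
  val (ft_delta K g *: q) f e = \sum_(h | (g * h == f)%g) val q h e.
Proof.
by rewrite /= funmod_deltaE sum_ffunE; apply: eq_bigl => h; rewrite andbT.
Qed.

Lemma cover_val0 f e : val (0 : cover) f e = 0.
Proof. by rewrite /= funmod0 ffunE. Qed.

Lemma cover_val_sum (I : Type) (s : seq I) (P : pred I) (F : I -> cover) f e :
  val (\sum_(i <- s | P i) F i) f e = \sum_(i <- s | P i) val (F i) f e.
Proof.
exact: (big_morph (fun q : cover => val q f e)
  (fun q r => cover_valD q r f e) (cover_val0 f e)).
Qed.

Hypothesis fX : fin_dim X.

Lemma cover_fin_dim : fin_dim cover.
Proof.
apply: (@fin_dim_sub _ _ cover (funmod false {ffun T -> X}) val).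
- exact: val_inj.
- by [].
- exact/fin_dim_funmod/fin_dim_ffun.
Qed.

Lemma cover_projective : projective cover.
Proof.
apply: (projective_coords (c := cover_coord)) => [|f c q r|g q h|q].
- exact: cover_fin_dim.
- apply: coverP => h e; rewrite cover_valD cover_valZ !cover_coordE.
  by case: ifP => _; rewrite ?cover_valD ?cover_valZ // scaler0 addr0.
- apply: coverP => f e; rewrite cover_val_sum cover_coordE cover_val_delta.
  case: ifP => fe.
    by apply: eq_bigr => i _; rewrite cover_coordE fe.
  by rewrite big1 // => i _; rewrite cover_coordE fe.
- apply: coverP => h e; rewrite cover_val_sum.
  (* The coordinate at [f] is supported on the diagonal, so only the term at [e] is pushed to [h]; a
     nonzero [q f e] then forces [h = f * e = f]. *)
  transitivity (\sum_(f : T) if (f * e == h)%g then val q f e else 0).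
    apply: eq_bigr => f _; rewrite cover_val_delta.
    rewrite big_mkcond (bigD1 e) //= big1 => [|g ge].
      by rewrite cover_coordE eqxx addr0.
    by rewrite cover_coordE (negPf ge) if_same.
  rewrite (bigD1 h) //= big1 => [|f fh].
    rewrite addr0; case: eqP => // he.
    by apply/esym/eqP; apply: contra_notT he => /eqP/cover_mulE.
  case: eqP => // fe; apply/eqP; apply: contraT => /eqP/cover_mulE.
  by rewrite fe => hf; rewrite hf eqxx in fh.
Qed.

Definition cover_proj_fun (f : T) (q : cover) : funmod false {ffun T -> X} :=
  [ffun h => if h == f then val q h else 0].

Lemma cover_proj_subproof f q :
  cover_proj_fun f q \in submod_pred is_cover_closed.
Proof.
apply/asboolP => h e; rewrite !ffunE; case: eqP => [_|_].
  by rewrite cover_grE; split=> // ?; apply: cover_eq0.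
by rewrite ffunE (klinear0 (gr_klinear gp e)).
Qed.

Definition cover_proj f q : cover := Submodule (cover_proj_subproof f q).

Lemma cover_projE f q h e : val (cover_proj f q) h e = if h == f then val q h e else 0.
Proof. by rewrite ffunE; case: ifP => // _; rewrite ffunE. Qed.

(** The grading is by the first index. For the support, a nonzero [q f e] has [f * e = f] and lies
    in [X_e], so the rank of [f] is at most that of [e], which is less than [j]. *)
Lemma cover_grading : grading j cover_proj.
Proof.
split=> [f c q r|q|f g q|g f q|g f q gf|f q fj]; apply: coverP => h e.
- rewrite cover_valD cover_valZ !cover_projE.
  by case: ifP => _; rewrite ?cover_valD ?cover_valZ // scaler0 addr0.
- rewrite cover_val_sum (bigD1 h) //= big1 => [|f fh].
    by rewrite cover_projE eqxx addr0.
  by rewrite cover_projE eq_sym (negPf fh).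
- rewrite !cover_projE; case: (h =P f) => [->|hf].
    by case: ifP => fg; rewrite ?cover_projE ?fg ?cover_val0.
  by case: ifP => fg; rewrite ?cover_val0 // cover_projE -(eqP fg); case: eqP hf.
- rewrite cover_projE; case: eqP => // hgf; rewrite cover_val_delta big1 // => k /eqP gk.
  by rewrite cover_projE; case: eqP => // kf; case: hgf; rewrite -gk kf.
- rewrite cover_val_delta cover_projE; case: eqP => [->|hf].
    rewrite (bigD1 f) ?gf //= cover_projE eqxx big1 ?addr0 // => k /andP[_ kf].
    by rewrite cover_projE (negPf kf).
  rewrite big1 // => k /eqP gk; rewrite cover_projE; case: eqP => // kf.
  by case: hf; rewrite -gk kf.
- rewrite cover_val0 cover_projE; case: eqP => // ->.
  rewrite -cover_grE; apply/eqP; apply: contraT => /eqP pe.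
  have fe : (f * e)%g = f.
    apply: (@cover_mulE q) => q0; apply: pe.
    by rewrite q0 (klinear0 (gr_klinear gp e)).
  case: pe; apply: (gr_supp gp); apply: leq_trans fj _.
  by rewrite -{1}fe ft_rank_mulr.
Qed.

(** The map [f] takes [X_e] into the component at [f * e = f]. So the surjection is homogeneous and
    its kernel inherits the grading. *)
Lemma cover_lin_proj f q : cover_lin (cover_proj f q) = p f (cover_lin q).
Proof.
rewrite /= /cover_map (klinear_sum (gr_klinear gp f)); apply: eq_bigr => h _.
rewrite (klinear_sum (gr_klinear gp f)); apply: eq_bigr => e _.
rewrite (gr_actE _ _ (cover_grE q h e)) cover_projE.
have [q0|/eqP q0] := eqVneq (val q h e) 0; first by rewrite q0 !if_same !scaler0 if_same.
by rewrite (cover_mulE q0) eq_sym; case: ifP => //; rewrite scaler0.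
Qed.

Local Notation syz := (kernel cover_lin).

Lemma syz_proj_subproof f (q : syz) : cover_proj f (val q) \in in_kernel cover_lin.
Proof.
have /eqP q0 := kernelP q.
by apply/eqP; rewrite cover_lin_proj q0 (klinear0 (gr_klinear gp f)).
Qed.

Definition syz_proj f (q : syz) : syz := Kernel (syz_proj_subproof f q).

(* If f has rank j - 1, the only nonzero component of q f is at the idempotent
   e with the same kernel as f, and it is determined by the image of q in X. *)
Lemma syz_supp f (q : syz) : (j.-1 <= ft_rank f)%N -> syz_proj f q = 0.
Proof.
move=> jf; apply: val_inj; rewrite /=.
have cg := cover_grading.
have [fj|fj] := leqP j (ft_rank f); first exact: (gr_supp cg).
have q0 e : e != ft_ker f -> val (val q) f e = 0.
  move=> ef; apply/eqP; apply: contraT => /eqP qn0.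
  have fe := cover_mulE qn0.
  have /andP[_ /eqP ke] : (f * e == f)%g && (ft_ker e == e).
    by apply: contra_notT qn0; exact: cover_eq0.
  (* [f * e = f] bounds the rank of [f] by that of [e], and [X_e] is nonzero only if [e] has rank at
     most [j - 1]. *)
  have er : ft_rank f = ft_rank e.
    apply/eqP; rewrite eqn_leq -{1}fe ft_rank_mulr /=.
    apply: contra_notT qn0; rewrite -ltnNge => fe'.
    by rewrite -cover_grE (gr_supp gp) //; lia.
  move: ef; rewrite -ke; case/eqP; apply: eq_ft_ker => i k.
  apply/eqP/eqP => [ik|]; first by rewrite -fe !ft_mulE ik.
  move=> ik; apply: (@ft_rank_mul_inj _ f e); first by rewrite fe.
  by rewrite -!ft_mulE fe.
(* The left side is the component at [f] of the image of [q] in [X], and that image is zero. *)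
have ker0 : ft_delta K f *: val (val q) f (ft_ker f) = 0.
  have := cover_lin_proj f (val q); have /eqP -> := kernelP q.
  rewrite (klinear0 (gr_klinear gp f)) => <-.
  rewrite /= /cover_map (bigD1 f) //= [X in _ + X]big1 => [|h hf].
    rewrite addr0 (bigD1 (ft_ker f)) //= big1 => [|e ef].
      by rewrite addr0 -[LHS]/(_ *: _) cover_projE eqxx.
    by rewrite cover_projE eqxx q0 // scaler0.
  by rewrite big1 // => e _; rewrite cover_projE (negPf hf) scaler0.
apply: coverP => h e; rewrite cover_projE cover_val0; case: eqP => // ->.
have [->|/q0 //] := eqVneq e (ft_ker f).
(* A section cancels [f]: [s * f = ft_ker f] is idempotent and fixes its own component. *)
have [s sf] := ft_section f.
have := congr1 (fun x => ft_delta K s *: x) ker0.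
rewrite ft_delta_scaleM sf scaler0 -cover_grE (gr_fix gp) //.
by rewrite ft_ker_idem // ft_kerK.
Qed.

Lemma syz_grading : grading j.-1 syz_proj.
Proof.
have cg := cover_grading.
split=> [f c q r|q|f g q|g f q|g f q gf|f q]; last exact: syz_supp;
  apply: val_inj => /=.
- exact: (gr_klinear cg f c (val q) (val r)).
- rewrite -[RHS](gr_sum cg (val q)).
  exact: (big_morph (val : syz -> cover) (fun _ _ => erefl) erefl).
- by rewrite (gr_orth cg); case: ifP.
- exact: (gr_act cg g f (val q)).
- exact: (gr_fix cg (val q) gf).
Qed.

Lemma syz_fin_dim : fin_dim syz.
Proof.
apply: (@fin_dim_sub _ _ syz cover val); last exact: cover_fin_dim.
  exact: val_inj.
by [].
Qed.

End Cover.

(** Each syzygy lowers the rank bound [j] by one, so after [m] steps it is at most [k] and there are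
    no maps from the graded projective to [M]. *)
Lemma grading_ext_vanishes (k j m : nat) (X M : lmodType A) (p : T -> X -> X) :
  grading j p -> fin_dim X ->
  (forall f (x : M), (ft_rank f < k)%N -> ft_delta K f *: x = 0) ->
  (j <= k + m)%N -> ext_vanishes X M m.
Proof.
elim: m j X p => [|m IHm] j X p gp fX Mk jkm.
  apply: (ext0_vanishes_cover (cover_projective (gp := gp) fX) (cover_surj gp)).
  by apply: (grading_hom0 (cover_grading gp) _ Mk); rewrite addn0 in jkm.
apply: (ext_vanishes_syzygy (cover_projective (gp := gp) fX) (cover_surj gp)).
by apply: (IHm _ _ _ (syz_grading gp) (syz_fin_dim gp fX) Mk); lia.
Qed.

End Grading.

(** * The idempotent [e_r], its symmetric group, and injections of r points *)

Section Idempotent.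
Variables (n r : nat) (r_gt0 : (0 < r)%N) (rn : (r <= n)%N).
Local Notation T := (fulltrans n).
Local Notation e := (ft_e n r).

Lemma ft_eE i : e i = (if (i < r)%N then i : nat else 0%N) :> nat.
Proof.
rewrite ffunE; case: ifP => // _; rewrite val_insubd.
by rewrite (leq_ltn_trans _ (ltn_ord i)).
Qed.

Lemma ft_e_lt i : (e i < r)%N.
Proof. by rewrite ft_eE; case: ifP. Qed.

Definition ft_retr (i : 'I_n) : 'I_r := Ordinal (ft_e_lt i).
Local Notation w := (widen_ord rn).

Lemma ft_retrE i : w (ft_retr i) = e i.
Proof. exact: val_inj. Qed.

Lemma ft_retrK j : ft_retr (w j) = j.
Proof. by apply: val_inj; rewrite /= ft_eE /= ltn_ord. Qed.

Definition ft_perm (s : 'S_r) : T := [ffun i => w (s (ft_retr i))].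

Lemma ft_permE s i : ft_perm s i = w (s (ft_retr i)).
Proof. exact: ffunE. Qed.

Lemma ft_perm1 : ft_perm 1%g = e.
Proof. by apply/ffunP => i; rewrite ft_permE perm1 ft_retrE. Qed.

(** The order is reversed because the product of ['S_r] applies its left factor first. *)
Lemma ft_permM s t : (ft_perm s * ft_perm t)%g = ft_perm (t * s)%g.
Proof. by apply/ffunP => i; rewrite ft_mulE !ft_permE ft_retrK permM. Qed.

Lemma ft_perm_e s : (ft_perm s * e)%g = ft_perm s.
Proof. by rewrite -ft_perm1 ft_permM mul1g. Qed.

Lemma ft_e_perm s : (e * ft_perm s)%g = ft_perm s.
Proof. by rewrite -ft_perm1 ft_permM mulg1. Qed.

Lemma ft_ee : (e * e)%g = e.
Proof. by rewrite -{2}ft_perm1 ft_e_perm ft_perm1. Qed.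

Lemma ft_perm_inj : injective ft_perm.
Proof.
move=> s t st; apply/permP => j; have := congr1 (fun f : T => f (w j)) st.
by rewrite !ft_permE ft_retrK => /(congr1 val) /= /val_inj.
Qed.

Lemma ft_rank_e : ft_rank e = r.
Proof.
rewrite /ft_rank; have -> : [set e i | i : 'I_n] = [set w j | j : 'I_r].
  apply/setP => i; apply/imsetP/imsetP => [[k _ ->]|[j _ ->]].
    by exists (ft_retr k); rewrite ?ft_retrE.
  by exists (w j); rewrite // -ft_retrE ft_retrK.
by rewrite card_imset ?card_ord // => i j /(congr1 val) /= /val_inj.
Qed.

Lemma ft_rank_mulg_perm s (f : T) : (f * e)%g = f ->
  ft_rank (f * ft_perm s)%g = ft_rank f.
Proof.
move=> fe; apply/eqP; rewrite eqn_leq ft_rank_mull /=.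
have {1}-> : f = (f * ft_perm s * ft_perm s^-1)%g.
  by rewrite -mulgA ft_permM mulVg ft_perm1.
exact: ft_rank_mull.
Qed.

Lemma ft_perm_units s : ft_perm s \in ft_units e.
Proof.
rewrite inE ft_e_perm ft_perm_e eqxx /=; apply/existsP; exists (ft_perm s^-1).
by rewrite ft_e_perm ft_perm_e eqxx !ft_permM mulgV mulVg ft_perm1 eqxx.
Qed.

Lemma ft_perm_restr s : ft_restr (ft_perm s) s.
Proof.
by move=> i j ij; rewrite ft_permE /= (_ : i = w j) ?ft_retrK //; apply: val_inj.
Qed.

(** Such maps correspond to the injections of [r] into [n]: [f * e = f] means that [f] is determined
    by its first r values. *)
Definition ft_valid (f : T) : bool := ((f * e)%g == f) && (ft_rank f == r).

Lemma ft_validP (f : T) : ft_valid f -> forall i j, (f i == f j) = (e i == e j).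
Proof.
move=> /andP[/eqP fe /eqP fr] i j; apply/eqP/eqP => [fij|eij].
  apply: (@ft_rank_mul_inj _ f e); first by rewrite fe fr ft_rank_e.
  by rewrite -!ft_mulE fe.
by rewrite -fe !ft_mulE eij.
Qed.

Lemma ft_valid_w (f : T) i j : ft_valid f -> (f (w i) == f (w j)) = (i == j).
Proof.
by move=> fv; rewrite (ft_validP fv) -!ft_retrE !ft_retrK.
Qed.

Lemma ft_valid_perm (f : T) : ft_valid f -> (e * f)%g = f -> exists s, f = ft_perm s.
Proof.
move=> fv ef.
have sI : injective (fun j => ft_retr (f (w j))).
  move=> i j ij; apply/eqP; rewrite -(ft_valid_w i j fv).
  by apply/eqP; rewrite -ef !ft_mulE -!ft_retrE ij.
exists (perm sI); apply/ffunP => i; rewrite ft_permE permE !ft_retrE -!ft_mulE.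
by have /andP[/eqP fe _] := fv; rewrite -mulgA fe ef.
Qed.

Lemma ft_rank_inj_mul (g f : T) : (forall i j, g (f i) = g (f j) -> f i = f j) ->
  ft_rank (g * f)%g = ft_rank f.
Proof.
move=> gf; rewrite /ft_rank ft_imsetM.
by apply: card_in_imset => _ _ /imsetP[i _ ->] /imsetP[j _ ->]; exact: gf.
Qed.

Lemma reindex_ft_perm (V : zmodType) (F : T -> V) s :
  (forall f : T, (f * e)%g <> f -> F f = 0) ->
  \sum_f F f = \sum_(f : T | (f * e)%g == f) F (f * ft_perm s)%g.
Proof.
move=> F0; rewrite (bigID (fun f : T => (f * e)%g == f)) /= [X in _ + X]big1; last first.
  by move=> f /eqP; exact: F0.
rewrite addr0 (reindex_onto (fun f : T => f * ft_perm s)%g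
  (fun f : T => f * ft_perm s^-1)%g).
  apply: eq_bigl => f; rewrite -!mulgA ft_perm_e eqxx ft_permM mulVg ft_perm1.
  by [].
by move=> f /eqP fe; rewrite -mulgA ft_permM mulgV ft_perm1.
Qed.

Lemma sum_ft_perm (V : zmodType) (F : T -> V) :
  (forall f, (forall s, f <> ft_perm s) -> F f = 0) ->
  \sum_f F f = \sum_s F (ft_perm s).
Proof.
move=> F0; rewrite (bigID (fun f : T => f \in codom ft_perm)) /=.
rewrite [X in _ + X]big1; last first.
  by move=> f fP; apply: F0 => s fs; rewrite fs codom_f in fP.
rewrite addr0 (reindex_onto ft_perm (fun f => odflt 1%g [pick s | ft_perm s == f])).
  apply: eq_bigl => s; rewrite codom_f /=; case: pickP => [t /eqP/ft_perm_inj ->|/(_ s)].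
    by rewrite eqxx.
  by rewrite eqxx.
move=> f /codomP[s ->]; case: pickP => [t /eqP //|/(_ s)]; by rewrite eqxx.
Qed.

End Idempotent.

(** * The module D(V) and its symmetric part *)

Section StandardModule.
Variables (K : numFieldType) (n r : nat) (r_gt0 : (0 < r)%N) (rn : (r <= n)%N).
Local Notation A := (ft_alg K n).
Local Notation T := (fulltrans n).
Local Notation e := (ft_e n r).
Local Notation pm := (ft_perm r_gt0 rn).
Local Notation w := (widen_ord rn).
Variable L : lmodType A.

(** D(V) for [V = e L]: coefficients are fixed by [e] and sit at valid maps. The truncated action
    drops the composites that cease to be injective on [r]. *)
Definition is_standard : {pred funmod true L} :=
  [pred q : funmod true L | `[< forall f, ft_delta K e *: q f = q f /\
    (~~ ft_valid r f -> q f = 0) >]].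

Lemma is_standard_closed : submod_closed is_standard.
Proof.
apply: ft_submod_closed => [|q t /asboolP Cq /asboolP Ct|c q /asboolP Cq|g q /asboolP Cq];
  apply/asboolP => f.
- by rewrite funmod0 scaler0.
- have [eq q0] := Cq f; have [et t0] := Ct f.
  rewrite funmodD scalerDr eq et; split=> // fv.
  by rewrite q0 ?t0 ?addr0.
- have [eq q0] := Cq f.
  rewrite funmod_algE ft_delta_scaleC eq; split=> // fv.
  by rewrite q0 ?scaler0.
- rewrite funmod_deltaE scaler_sumr; split.
    by apply: eq_bigr => h _; case: (Cq h).
  move=> fv; apply: big1 => h /andP[/eqP gh /eqP kh]; have [_] := Cq h; apply.
  apply: contra fv => /andP[/eqP he hr].
  by rewrite /ft_valid -gh -mulgA he eqxx kh.
Qed.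

Definition standard : lmodType A := submodule is_standard_closed.

Lemma standard_e (q : standard) f : ft_delta K e *: val q f = val q f.
Proof. by have /asboolP/(_ f)[] := submoduleP q. Qed.

Lemma standard0 (q : standard) f : ~~ ft_valid r f -> val q f = 0.
Proof. by have /asboolP/(_ f)[] := submoduleP q. Qed.

Lemma standardP (q t : standard) : (forall f, val q f = val t f) -> q = t.
Proof. by move=> qt; apply/val_inj/ffunP => f; exact: qt. Qed.

Lemma standard_valD (q t : standard) f : val (q + t) f = val q f + val t f.
Proof. by rewrite /= funmodD. Qed.

Lemma standard_valZ c (q : standard) f : val (c%:A *: q) f = c%:A *: val q f.
Proof. by rewrite /= funmod_algE. Qed.

Lemma standard_val0 f : val (0 : standard) f = 0.
Proof. by rewrite /= funmod0. Qed.

Lemma standard_val_sum (I : Type) (s : seq I) (P : pred I) (F : I -> standard) f :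
  val (\sum_(i <- s | P i) F i) f = \sum_(i <- s | P i) val (F i) f.
Proof.
exact: (big_morph (fun q : standard => val q f)
  (fun q t => standard_valD q t f) (standard_val0 f)).
Qed.

Lemma standard_val_delta g (q : standard) f :
  val (ft_delta K g *: q) f =
  \sum_(h | (g * h == f)%g && (ft_rank (g * h)%g == ft_rank h)) val q h.
Proof. by rewrite /= funmod_deltaE. Qed.

Lemma standard_fin_dim (W : vectType K) (phi : L -> W) :
  {in [pred x | ft_delta K e *: x == x] &, injective phi} ->
  (forall c x y, ft_delta K e *: x = x -> ft_delta K e *: y = y ->
     phi (c%:A *: x + y) = c *: phi x + phi y) ->
  fin_dim standard.
Proof.
move=> phiI phiK.
exists {ffun T -> W}, (fun q : standard => [ffun f => phi (val q f)]); split.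
  move=> q t /ffunP qt; apply: standardP => f; have := qt f; rewrite !ffunE.
  by apply: phiI; rewrite inE standard_e.
move=> c q t; apply/ffunP => f; rewrite ffunE standard_valD standard_valZ.
by rewrite phiK ?standard_e // !ffunE.
Qed.

Definition standard_proj_fun (f : T) (q : standard) : funmod true L :=
  [ffun h => if h == f then val q h else 0].

Lemma standard_proj_subproof f q :
  standard_proj_fun f q \in submod_pred is_standard_closed.
Proof.
apply/asboolP => h; rewrite !ffunE; case: eqP => [_|_]; last by rewrite scaler0.
by rewrite standard_e; split=> // ?; apply: standard0.
Qed.

Definition standard_proj f q : standard := Submodule (standard_proj_subproof f q).

Lemma standard_projE f q h : val (standard_proj f q) h = if h == f then val q h else 0.
Proof. by rewrite ffunE. Qed.

(** The support has rank exactly [r], while a grading bounds ranks strictly; hence [r.+1]. *)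
Lemma standard_grading : grading r.+1 standard_proj.
Proof.
split=> [f c q t|q|f g q|g f q|g f q gf|f q fj]; apply: standardP => h.
- rewrite standard_valD standard_valZ !standard_projE.
  by case: ifP => _; rewrite ?standard_valD ?standard_valZ // scaler0 addr0.
- rewrite standard_val_sum (bigD1 h) //= big1 => [|f fh].
    by rewrite standard_projE eqxx addr0.
  by rewrite standard_projE eq_sym (negPf fh).
- rewrite !standard_projE; case: (h =P f) => [->|hf].
    by case: ifP => fg; rewrite ?standard_projE ?fg ?standard_val0.
  case: ifP => fg; rewrite ?standard_val0 // standard_projE -(eqP fg).
  by case: eqP hf.
- rewrite standard_projE; case: eqP => // hgf.
  rewrite standard_val_delta big1 // => k /andP[/eqP gk _].
  by rewrite standard_projE; case: eqP => // kf; case: hgf; rewrite -gk kf.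
- rewrite standard_val_delta standard_projE; case: eqP => [->|hf].
    rewrite (bigD1 f) ?gf ?eqxx //= standard_projE eqxx big1 ?addr0 // => k /andP[_ kf].
    by rewrite standard_projE (negPf kf).
  rewrite big1 // => k /andP[/eqP gk _]; rewrite standard_projE; case: eqP => // kf.
  by case: hf; rewrite -gk kf.
- rewrite standard_val0 standard_projE; case: eqP => // ->.
  apply: standard0; rewrite negb_and; apply/orP; right.
  by rewrite neq_ltn fj orbT.
Qed.

Hypothesis L_low : forall (f : T) (x : L), (ft_rank f < r)%N -> ft_delta K f *: x = 0.

Definition standard_map (q : standard) : L := \sum_f ft_delta K f *: val q f.

(** The terms dropped by the truncated action have rank less than [r], so they act as zero on [L]
    too. *)
Lemma standard_map_linear : linear standard_map.
Proof.
apply: klinear_linear => [c q t|g q].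
  rewrite /standard_map scaler_sumr -big_split; apply: eq_bigr => f _ /=.
  by rewrite funmodD funmod_algE scalerDr ft_delta_scaleC.
rewrite /standard_map scaler_sumr.
under eq_bigr do rewrite standard_val_delta scaler_sumr.
rewrite (exchange_big_dep predT) //=; apply: eq_bigr => f _.
rewrite ft_delta_scaleM; have [fv|fv] := boolP (ft_valid r f); last first.
  by rewrite standard0 // scaler0 big1 // => ? _; rewrite scaler0.
have /andP[_ /eqP fr] := fv.
case: (ft_rank (g * f)%g =P ft_rank f) => [gf|gf].
  by rewrite (big_pred1 (g * f)%g) // => h; rewrite andbT eq_sym.
rewrite big1 => [|h]; last by rewrite andbF.
rewrite L_low // -fr; have := ft_rank_mulr g f; lia.
Qed.

Definition standard_lin : {linear standard -> L} := to_linear standard_map_linear.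

(** Invariance under the symmetric group acting at once on injections, by precomposition, and on
    coefficients. *)
Definition is_sym : {pred standard} :=
  [pred q : standard | `[< forall s (f : T), (f * e)%g = f ->
    ft_delta K (pm s) *: val q (f * pm s)%g = val q f >]].

Lemma is_sym_closed : submod_closed is_sym.
Proof.
apply: ft_submod_closed => [|q t /asboolP Cq /asboolP Ct|c q /asboolP Cq|g q /asboolP Cq];
  apply/asboolP => s f fe.
- by rewrite !standard_val0 scaler0.
- by rewrite !standard_valD scalerDr Cq ?Ct.
- by rewrite !standard_valZ ft_delta_scaleC Cq.
- rewrite !standard_val_delta scaler_sumr big_mkcond [RHS]big_mkcond /=.
  rewrite (reindex_ft_perm r_gt0 rn s) => [|h he]; last first.
    by rewrite standard0 ?scaler0 ?if_same // /ft_valid; case: eqP he.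
  rewrite big_mkcond; apply: eq_bigr => h _; case: ifPn => [/eqP he|he]; last first.
    by rewrite standard0 ?if_same // /ft_valid (negPf he).
  rewrite mulgA !ft_rank_mulg_perm ?Cq //; last by rewrite -mulgA he.
  congr (if _ && _ then _ else _); apply/eqP/eqP => [ghs|-> //].
  have := congr1 (fun x : T => (x * pm s^-1)%g) ghs.
  by rewrite -!mulgA ft_permM mulVg ft_perm1 he fe.
Qed.

Definition symstd : lmodType A := submodule is_sym_closed.

Lemma symstdE (q : symstd) s (f : T) : (f * e)%g = f ->
  ft_delta K (pm s) *: val (val q) (f * pm s)%g = val (val q) f.
Proof. by move=> fe; have /asboolP/(_ s f fe) := submoduleP q. Qed.

Definition sym_map (q : symstd) : L := standard_lin (val q).

Lemma sym_map_linear : linear sym_map.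
Proof. by move=> a q t; rewrite /sym_map !linearP. Qed.

Definition sym_lin : {linear symstd -> L} := to_linear sym_map_linear.

Lemma sym_val_delta g (q : symstd) f :
  val (val (ft_delta K g *: q)) f =
  \sum_(h | (g * h == f)%g && (ft_rank (g * h)%g == ft_rank h)) val (val q) h.
Proof. exact: standard_val_delta. Qed.

Lemma symP (q t : symstd) : (forall f, val (val q) f = val (val t) f) -> q = t.
Proof. by move=> qt; apply/val_inj/standardP. Qed.

Definition avg_fun (q : standard) : funmod true L :=
  [ffun f : T => if (f * e)%g == f then
     ((r`!)%:R^-1 : K)%:A *: \sum_s ft_delta K (pm s) *: val q (f * pm s)%g else 0].

Lemma avg_standard q : avg_fun q \in submod_pred is_standard_closed.
Proof.
apply/asboolP => f; rewrite ffunE; case: eqP => fe; last by rewrite scaler0.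
rewrite ft_delta_scaleC scaler_sumr; split.
  by congr (_ *: _); apply: eq_bigr => s _; rewrite ft_delta_scaleM ft_e_perm.
move=> fv; rewrite big1 ?scaler0 // => s _; rewrite standard0 ?scaler0 //.
apply: contra fv; rewrite /ft_valid ft_rank_mulg_perm // fe eqxx.
by case/andP.
Qed.

Lemma avg_sym q : (Submodule (avg_standard q) : standard) \in submod_pred is_sym_closed.
Proof.
apply/asboolP => s f fe; rewrite /= !ffunE -mulgA ft_perm_e fe !eqxx.
rewrite ft_delta_scaleC scaler_sumr; congr (_ *: _).
rewrite [RHS](reindex_inj (mulIg s)); apply: eq_bigr => t _ /=.
by rewrite ft_delta_scaleM -mulgA ft_permM.
Qed.

Definition avg q : symstd := Submodule (avg_sym q).

(** Moving a permutation from the injection to the coefficient does not change the image in [L], so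
    all r! terms of the average contribute equally; r! is invertible in a [numFieldType]. *)
Lemma sym_lin_avg q : sym_lin (avg q) = standard_lin q.
Proof.
rewrite /= /sym_map /= /standard_map.
under eq_bigr => f do rewrite /= ffunE.
pose F (f : T) := ft_delta K f *: val q f.
have F0 (f : T) : (f * e)%g <> f -> F f = 0.
  by move=> fe; rewrite /F standard0 ?scaler0 // /ft_valid; case: eqP fe.
transitivity (((r`!)%:R^-1 : K)%:A *: \sum_(s : 'S_r) \sum_f F f); last first.
  rewrite sumr_const card_Sn -scaler_nat scalerA -[(_%:R : A)]scaler_nat.
  rewrite -scalerAl mul1r scalerA mulVf ?scale_alg1 //.
  by rewrite pnatr_eq0 -lt0n fact_gt0.
under [in RHS]eq_bigr => s do rewrite (reindex_ft_perm r_gt0 rn s F0).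
rewrite exchange_big scaler_sumr [RHS]big_mkcond; apply: eq_bigr => f _ /=.
case: eqP => fe; last by rewrite scaler0.
rewrite ft_delta_scaleC scaler_sumr; congr (_ *: _); apply: eq_bigr => s _.
by rewrite ft_delta_scaleM.
Qed.

(** The image of D(V) is a submodule containing the nonzero vector [e x0], hence all of [L];
    averaging preserves the image. *)
Lemma sym_surj : simple_module L -> (exists x : L, ft_delta K e *: x != 0) ->
  forall x, exists q, sym_lin q = x.
Proof.
move=> [_ simpL] [x0 ex0].
pose S : {pred L} := [pred x | `[< exists q, standard_lin q = x >]].
have Sc : submod_closed S.
  split=> [|a x y /asboolP[q qx] /asboolP[t ty]]; apply/asboolP.
    by exists 0; rewrite linear0.
  by exists (a *: q + t); rewrite linearP qx ty.
pose q0 : funmod true L := [ffun f => if f == e then ft_delta K e *: x0 else 0].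
have ev : ft_valid r e by rewrite /ft_valid (ft_ee r_gt0 rn) (ft_rank_e r_gt0 rn) !eqxx.
have Cq : q0 \in submod_pred is_standard_closed.
  apply/asboolP => f; rewrite ffunE; case: eqP => [->|_]; last by rewrite scaler0.
  by rewrite ft_delta_scaleM (ft_ee r_gt0 rn) ev.
have Sx0 : ft_delta K e *: x0 \in S.
  apply/asboolP; exists (Submodule Cq).
  rewrite /= /standard_map (bigD1 e) //= big1 => [|f fe].
    by rewrite addr0 ffunE eqxx ft_delta_scaleM (ft_ee r_gt0 rn).
  by rewrite ffunE (negPf fe) scaler0.
have [S0|ST] := simpL S Sc; first by rewrite S0 inE (negPf ex0) in Sx0.
move=> x; have /asboolP[q qx] : x \in S by rewrite ST.
by exists (avg q); rewrite sym_lin_avg.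
Qed.

Hypothesis no_sign : forall x : L, ft_delta K e *: x = x ->
  (forall i j : 'I_r, i != j -> ft_delta K (pm (tperm i j)) *: x = - x) -> x = 0.

Lemma sym_valid (q : symstd) f : val (val q) f <> 0 -> ft_valid r f.
Proof. by move=> qf; apply: contra_notT qf; exact: standard0. Qed.

Lemma sym_delta_neq0 g (q : symstd) f : val (val (ft_delta K g *: q)) f <> 0 ->
  exists2 h, (g * h)%g = f & ft_valid r h.
Proof.
rewrite sym_val_delta => qf; apply/exists2P; apply: contra_notP qf => nh.
rewrite big1 // => h /andP[/eqP gh _]; apply: standard0.
by apply/negP => hv; apply: nh; exists h.
Qed.

(** The element [t = g q] is supported on permutations of [r]. By symmetry its image in [L] is r!
    times its coefficient at [e], and that coefficient determines all the others. *)
Lemma sym_lin_delta_eq0 g (q : symstd) : sym_lin q = 0 -> (e * g)%g = g ->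
  ft_delta K g *: q = 0.
Proof.
move=> q0 eg; set t := _ *: q.
have t0 : sym_lin t = 0 by rewrite /t linearZ /= -[sym_map q]/(sym_lin q) q0 scaler0.
have tP f : (forall s, f <> pm s) -> val (val t) f = 0.
  move=> fs; apply/eqP; apply: contraT => /eqP tf.
  have fv := sym_valid tf; have [h hE _] := sym_delta_neq0 tf.
  have [|s fE] := ft_valid_perm r_gt0 rn fv; first by rewrite -hE mulgA eg.
  by have := fs s.
have te : val (val t) e = 0.
  move: t0; rewrite /= /sym_map /= /standard_map.
  rewrite (@sum_ft_perm _ _ r_gt0 rn) => [|f fs]; last first.
    by rewrite tP ?scaler0.
  have E s : ft_delta K (pm s) *: val (val t) (pm s) = val (val t) e.
    by rewrite -{2}(ft_e_perm r_gt0 rn s) symstdE // (ft_ee r_gt0 rn).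
  under eq_bigr do rewrite E.
  rewrite sumr_const card_Sn => /(congr1 (fun x => ((r`!)%:R^-1 : K)%:A *: x)).
  rewrite scaler0 -scaler_nat scalerA -[(_%:R : A)]scaler_nat.
  rewrite -scalerAl mul1r scalerA mulVf ?scale_alg1 //.
  by rewrite pnatr_eq0 -lt0n fact_gt0.
apply: symP => f; rewrite standard_val0.
have [[s ->]|fs] := pselect (exists s, f = pm s); last first.
  by apply: tP => s fE; apply: fs; exists s.
have : ft_delta K (pm s^-1) *: (ft_delta K (pm s) *: val (val t) (e * pm s)%g) = 0.
  by rewrite symstdE ?te ?scaler0 // (ft_ee r_gt0 rn).
rewrite ft_delta_scaleM ft_permM mulgV ft_perm1 standard_e ft_e_perm.
by [].
Qed.

(** A nonzero coefficient of [g q] at [f] forces [f] and [g] to have the same image. If [k * f = e],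
    then [g = f * (k * g)], and [k * g] falls under the preceding case. *)
Lemma sym_lin_delta_low g (q : symstd) : sym_lin q = 0 -> (ft_rank g <= r)%N ->
  ft_delta K g *: q = 0.
Proof.
move=> q0 gr; apply: symP => f; rewrite standard_val0.
apply/eqP; apply: contraT => /eqP qf; have [h hE hv] := sym_delta_neq0 qf.
have fv := sym_valid qf; have /andP[/eqP fe /eqP fr] := fv.
have [k kf] : exists k : T, (k * f)%g = e.
  by apply: ft_left_factor => i j /eqP; rewrite (ft_validP r_gt0 rn fv) => /eqP.
have im i : exists j, g i = f j.
  have : g i \in [set f j | j : 'I_n].
    have /eqP -> : [set f j | j : 'I_n] == [set g j | j : 'I_n].
      rewrite eqEcard [X in _ && X](_ : _ = true) ?andbT; last first.
        by rewrite -[X in (X <= _)%N]/(ft_rank g) -[X in (_ <= X)%N]/(ft_rank f) fr.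
      apply/fintype.subsetP => _ /imsetP[j _ ->].
      by rewrite -hE ft_mulE imset_f.
    exact: imset_f.
  by case/imsetP => j _ ->; exists j.
have gE : g = (f * (k * g))%g.
  apply/ffunP => i; have [j gj] := im i.
  by rewrite !ft_mulE gj -(ft_mulE k f) kf -(ft_mulE f) fe.
have kg0 : ft_delta K (k * g)%g *: q = 0.
  apply: sym_lin_delta_eq0 => //; apply/ffunP => i; have [j gj] := im i.
  by rewrite !ft_mulE gj -(ft_mulE k f) kf -(ft_mulE e) (ft_ee r_gt0 rn).
by case: qf; rewrite gE -ft_delta_scaleM kg0 scaler0 standard_val0.
Qed.

Definition collapse (b a : 'I_n) : T := [ffun x => if x == b then a else x].

(* Collapsing b onto a kills chi; the coefficient of the result at
   [collapse b a * f] is the sum of those of chi at f and at [collapse b a * f]. *)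
Lemma sym_exchange (chi : symstd) (f : T) (a b : 'I_n) i0 :
  ft_delta K (collapse b a) *: chi = 0 -> ft_valid r f -> f i0 = b ->
  (forall i, f i != a) ->
  [/\ val (val chi) (collapse b a * f)%g = - val (val chi) f,
      ft_valid r (collapse b a * f)%g & forall i, (collapse b a * f)%g i != b].
Proof.
move=> chi0 fv fi0 fa; set c := collapse b a.
have ba : b != a by rewrite -fi0.
have cE x : c x = if x == b then a else x by rewrite ffunE.
have cb i : (c * f)%g i != b.
  by rewrite ft_mulE cE; case: ifPn => // _; rewrite eq_sym.
have cr : ft_rank (c * f)%g = ft_rank f.
  apply: ft_rank_inj_mul => i j; rewrite !cE.
  case: eqP => [->|_]; case: eqP => [->|_] //.
    by move=> aj; have := fa j; rewrite -aj eqxx.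
  by move=> ia; have := fa i; rewrite ia eqxx.
have cv : ft_valid r (c * f)%g.
  by have /andP[/eqP fe fr] := fv; rewrite /ft_valid -mulgA fe eqxx cr.
have cc : (c * (c * f))%g = (c * f)%g.
  by apply/ffunP => i; rewrite ft_mulE cE (negPf (cb i)).
split=> //; apply/eqP; rewrite -addr_eq0 addrC; apply/eqP.
have := congr1 (fun q : symstd => val (val q) (c * f)%g) chi0.
rewrite sym_val_delta standard_val0 => <-.
rewrite (bigD1 f) /= ?cr ?eqxx //; congr (_ + _).
have cff : (c * f)%g != f.
  by apply/eqP => cf; have := cb i0; rewrite cf fi0 eqxx.
rewrite (bigD1 (c * f)%g) /=; last by rewrite cc !eqxx.
rewrite big1 ?addr0 // => h /andP[/andP[/andP[/eqP ch _] hf] hcf].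
apply: standard0; apply/negP => hv.
(* A valid [h] with [c * h = c * f] agrees with [f] away from the fibre over [b], and is constantly
   [b] or [a] on that fibre: it is [f] or [c * f]. *)
have chE i : c (h i) = c (f i) by rewrite -!ft_mulE ch.
have hfE i j : (h i == h j) = (f i == f j).
  by rewrite (ft_validP r_gt0 rn hv) (ft_validP r_gt0 rn fv).
have hi i : f i != b -> h i = f i.
  move=> fb; have := chE i; rewrite !cE (negPf fb); case: eqP => // _ af.
  by have := fa i; rewrite -af eqxx.
have [hb|hb] := eqVneq (h i0) b.
  case/eqP: hf; apply/ffunP => i; have [fb|/hi //] := eqVneq (f i) b.
  by rewrite fb -hb; apply/eqP; rewrite hfE fb fi0.
case/eqP: hcf; apply/ffunP => i; rewrite ft_mulE cE.
have [fb|/hi //] := eqVneq (f i) b.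
have -> : h i = h i0 by apply/eqP; rewrite hfE fb fi0.
by have := chE i0; rewrite !cE fi0 eqxx (negPf hb).
Qed.

(** Induction on the rank of [g] above [r]: collapsing two points of the image of [g] lowers the
    rank, which makes the exchange lemma applicable to [chi = g q]. *)
Lemma sym_lin_ker g (q : symstd) : sym_lin q = 0 -> ft_delta K g *: q = 0.
Proof.
move=> q0; have [d] := ubnP (ft_rank g - r)%N; elim: d g => // d IHd g gd.
have [gr|gr] := leqP (ft_rank g) r; first exact: sym_lin_delta_low.
have IH h : (ft_rank h < ft_rank g)%N -> ft_delta K h *: q = 0.
  by move=> hg; apply: IHd; lia.
set chi := _ *: q; apply: symP => f; rewrite standard_val0.
apply/eqP; apply: contraT => /eqP chif; have [h hE hv] := sym_delta_neq0 chif.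
have fv := sym_valid chif; have /andP[/eqP fe /eqP fr] := fv.
have coll a b : a != b -> (exists i, g i = a) -> (exists i, g i = b) ->
    ft_delta K (collapse b a) *: chi = 0.
  move=> ab [i gi] [j gj]; rewrite /chi ft_delta_scaleM IH //.
  rewrite ltn_neqAle ft_rank_mulr andbT; apply/eqP => /ft_rank_mul_inj/(_ i j).
  rewrite gi gj !ffunE eqxx if_same => /(_ erefl) abE.
  by rewrite abE eqxx in ab.
have [a [ag af]] : exists a, (exists i, g i = a) /\ forall i, f i != a.
  have : ~~ ([set g i | i : 'I_n] \subset [set f i | i : 'I_n]).
    by apply/negP => /subset_leq_card; rewrite -/(ft_rank g) -/(ft_rank f) fr leqNgt gr.
  case/fintype.subsetPn => a /imsetP[i _ ->] af; exists (g i); split; first by exists i.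
  by move=> k; apply: contra af => /eqP <-; exact: imset_f.
have fg i : exists k, g k = f i by exists (h i); rewrite -hE ft_mulE.
case: chif; apply: no_sign; first exact: standard_e.
move=> i j ij; set b := f (w i); set b' := f (w j).
have bb' : b != b' by rewrite (ft_valid_w r_gt0 rn _ _ fv).
have ab : a != b by rewrite eq_sym af.
have ab' : a != b' by rewrite eq_sym af.
have [E1 v1 m1] := sym_exchange (coll a b ab ag (fg _)) fv (erefl b) af.
set f1 := (_ * _)%g in E1 v1 m1.
have f1j : f1 (w j) = b' by rewrite /f1 ft_mulE ffunE -/b' eq_sym (negPf bb').
have [E2 v2 m2] := sym_exchange (coll b b' bb' (fg _) (fg _)) v1 f1j m1.
set f2 := (_ * _)%g in E2 v2 m2.
have f2i : f2 (w i) = a.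
  by rewrite /f2 /f1 !ft_mulE !ffunE -/b eqxx (negPf ab').
have [|E3 v3 _] := sym_exchange (coll b' a _ (fg _) ag) v2 f2i m2.
  by rewrite eq_sym.
set f3 := (_ * _)%g in E3 v3.
have f3E : f3 = (f * pm (tperm i j))%g.
  have /andP[/eqP f3e _] := v3; rewrite -f3e; apply/ffunP => x.
  rewrite !ft_mulE ft_permE -(ft_retrE r_gt0 rn) !ffunE.
  set k := ft_retr _ _; case: tpermP => [->|->|/eqP ki /eqP kj].
  - by rewrite -/b -/b' !eqxx (negPf ab') eqxx.
  - rewrite -/b -/b' [b' == b]eq_sym (negPf bb') eqxx.
    by rewrite [b == a]eq_sym (negPf ab).
  - rewrite -/b -/b' /b /b' !(ft_valid_w r_gt0 rn _ _ fv).
    by rewrite (negPf ki) (ft_valid_w r_gt0 rn _ _ fv) (negPf kj) (negPf (af _)).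
have := symstdE chi (tperm i j) fe; rewrite -f3E E3 E2 E1 opprK scalerN.
by move=> /(congr1 -%R); rewrite opprK.
Qed.

Lemma sym_lin_inj : injective sym_lin.
Proof.
move=> q t qt; apply/eqP; rewrite -subr_eq0; apply/eqP.
rewrite -[LHS]ft_delta_scale1; apply: sym_lin_ker.
by rewrite linearB qt subrr.
Qed.

(** The splitting is the inverse of the bijection [sym_lin], followed by the inclusion of the
    symmetric part. *)
Lemma standard_retract : simple_module L -> (exists x : L, ft_delta K e *: x != 0) ->
  exists i : {linear L -> standard}, cancel i standard_lin.
Proof.
move=> simpL ex0; have [g gE] := choice (sym_surj simpL ex0).
have glin : linear (fun x => val (g x)).
  move=> a x y; have -> // : g (a *: x + y) = a *: g x + g y.
  by apply: sym_lin_inj; rewrite linearP !gE.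
exists (to_linear glin) => x; exact: gE.
Qed.


End StandardModule.

(** * Partitions and Specht modules *)

Lemma size_le_sumn s : all (leq 1) s -> (size s <= sumn s)%N.
Proof. by elim: s => //= a s IHs /andP[a1 /IHs]; lia. Qed.

Lemma sumn_le_size s : all (leq 1) s -> (sumn s <= size s)%N -> s = nseq (size s) 1%N.
Proof.
elim: s => //= a s IHs /andP[a1 s1] asl; have ss := size_le_sumn s1.
by rewrite [in LHS]IHs //; [congr (_ :: _)|]; lia.
Qed.

Section Specht.
Variables (K : numFieldType) (r : nat) (lam : seq nat).
Hypothesis lam_part : is_part r lam.

(** Entries in distinct rows fill all [r] row indices, so [lam] has [r] positive parts with sum
    [r]. *)
Lemma tableau_column (t : tableau r) : is_tableau lam t ->
  injective (fun i => (t i).1) -> lam = nseq r 1%N.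
Proof.
move=> /andP[_ /forallP tl] tI.
have /and3P[_ lam1 /eqP lamr] := lam_part.
have rl : (r <= size lam)%N.
  rewrite leqNgt; apply/negP => lr.
  have /codomP[i iE] : Ordinal lr \in codom (fun i => (t i).1) by exact: inj_card_onto.
  have := tl i; rewrite nth_default //; exact: (eq_leq (congr1 val iE)).
have sl : (size lam <= r)%N by rewrite -lamr size_le_sumn.
rewrite [LHS]sumn_le_size ?lamr //.
by congr nseq; apply/eqP; rewrite eqn_leq rl sl.
Qed.

(** Rows and columns number at most [r], so the diagram fits in the square of positions; any
    enumeration of its [r] boxes is a tableau. *)
Lemma exists_tableau : exists t : tableau r, is_tableau lam t.
Proof.
have /and3P[_ lam1 /eqP lamr] := lam_part.
pose C := [set c : 'I_r * 'I_r | (c.2 < nth 0 lam c.1)%N].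
have lr a : (nth 0 lam a <= r)%N.
  have [al|al] := ltnP a (size lam); last by rewrite nth_default.
  rewrite -lamr sumnE (big_nth 0%N) big_mkord (bigD1 (Ordinal al)) //=.
  exact: leq_addr.
have sl : (size lam <= r)%N by rewrite -lamr size_le_sumn.
have Cr : #|C| = r.
  transitivity (\sum_(a < r) \sum_(b < r | (b < nth 0 lam a)%N) 1)%N.
    by rewrite pair_big_dep -sum1_card; apply: eq_bigl => c; rewrite inE.
  transitivity (\sum_(a < r) nth 0 lam a)%N; last first.
    rewrite -[RHS]lamr sumnE (big_nth 0%N) big_mkord (big_ord_widen _ _ sl).
    rewrite [RHS]big_mkcond; apply: eq_bigr => a _.
    by case: ltnP => // al; rewrite nth_default.
  apply: eq_bigr => a _.
  rewrite -(big_ord_widen _ (fun=> 1%N) (lr a)).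
  by rewrite sum1_card card_ord.
exists [ffun i => enum_val (cast_ord (esym Cr) i)]; apply/andP; split.
  by apply/injectiveP => i j; rewrite !ffunE => /enum_val_inj/cast_ord_inj.
apply/forallP => i; rewrite ffunE.
by have := enum_valP (cast_ord (esym Cr) i); rewrite inE.
Qed.

Lemma polytabloidE (t : tableau r) T : polytabloid K t T =
  \sum_(s in col_stab t) (-1) ^+ s * (T == tabloid_of (perm_tableau s t))%:R.
Proof. by rewrite sum_ffunE; apply: eq_bigr => s _; rewrite !ffunE. Qed.

(** The coefficient at the tabloid of [t] is 1: a column permutation that keeps every entry in its
    row is the identity. *)
Lemma polytabloid_neq0 (t : tableau r) : is_tableau lam t -> polytabloid K t != 0.
Proof.
move=> /andP[/injectiveP tI _]; apply/eqP => /ffunP/(_ (tabloid_of t)).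
rewrite polytabloidE ffunE (bigD1 1%g) /=; last first.
  by rewrite inE; apply/forallP => i; rewrite perm1.
rewrite big1 ?addr0 => [|s /andP[]].
  rewrite (_ : perm_tableau 1 t = t) ?eqxx ?odd_perm1 ?mul1r => [/eqP|].
    by rewrite oner_eq0.
  by apply/ffunP => i; rewrite ffunE invg1 perm1.
rewrite inE => /forallP st s1; case: eqP => [ts|_]; last by rewrite mulr0.
case/eqP: s1; apply/permP => i; rewrite perm1.
have /ffunP/(_ (s i)) := ts; rewrite !ffunE permK => row.
by apply: tI; rewrite [LHS]surjective_pairing [RHS]surjective_pairing row (eqP (st i)).
Qed.

Lemma specht_neq0 : exists2 v, v \in specht K r lam & v != 0.
Proof.
have [t tP] := exists_tableau; exists (polytabloid K t); last exact: polytabloid_neq0.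
by apply/memv_span/map_f; rewrite mem_enum.
Qed.

Lemma perm_actE s (v : tabloid_space K r) T :
  perm_act s v T = v (perm_tabloid s^-1 T).
Proof.
have pK : cancel (@perm_tabloid r s) (perm_tabloid s^-1).
  by move=> U; apply/ffunP => i; rewrite !ffunE invgK permK.
have pK' : cancel (perm_tabloid s^-1) (@perm_tabloid r s).
  by move=> U; apply/ffunP => i; rewrite !ffunE invgK permKV.
rewrite sum_ffunE (bigD1 (perm_tabloid s^-1 T)) //= big1 => [|U UT].
  by rewrite !ffunE pK' eqxx addr0 [LHS]mulr1.
rewrite !ffunE; case: eqP => [TU|_]; last by rewrite scaler0.
by rewrite TU pK eqxx in UT.
Qed.

(** If an injective [T] occurred in a polytabloid, the tableau would have all entries in distinct
    rows, so [lam] would be a single column. *)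
Lemma specht_eq0 v (T : tabloid r) : lam <> nseq r 1%N -> v \in specht K r lam ->
  injective T -> v T = 0.
Proof.
move=> lam1 vS TI.
have := vS; rewrite /specht -[map _ _]in_tupleE => /coord_span ->.
rewrite sum_ffunE big1 // => i _; rewrite ffunE.
set P := _`_i; have : P \in [seq polytabloid K t | t <- enum (is_tableau lam)].
  by apply: mem_nth; exact: ltn_ord.
case/mapP => t; rewrite mem_enum => tP ->; rewrite polytabloidE big1 ?scaler0 //.
move=> s _; case: eqP => [TE|_]; last by rewrite mulr0.
case: lam1; apply: (tableau_column tP) => i1 i2 ti; apply: (@perm_inj _ s).
by apply: TI; rewrite TE !ffunE !permK.
Qed.

(** A tabloid with two entries in one row is fixed by their transposition, so the coefficient of [v]
    there equals its own negative. *)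
Lemma specht_no_sign v : lam <> nseq r 1%N -> v \in specht K r lam ->
  (forall i j : 'I_r, i != j -> perm_act (tperm i j) v = - v) -> v = 0.
Proof.
move=> lam1 vS vs; apply/ffunP => T; rewrite ffunE.
have [/injectiveP TI|] := boolP (injectiveb T); first exact: (specht_eq0 lam1).
move=> /injectivePn[i [j ij Tij]].
have := congr1 (fun u : tabloid_space K r => u T) (vs _ _ ij).
rewrite perm_actE ffunE (_ : perm_tabloid _ T = T) => [/eqP|].
  by rewrite -addr_eq0 -mulr2n mulrn_eq0 => /eqP.
by apply/ffunP => k; rewrite ffunE invgK; case: tpermP => [->|->|].
Qed.

End Specht.

(** * Vanishing of Ext *)

Lemma is_L_ext_vanishes (K : numFieldType) (n k r m : nat) (lam : seq nat)
    (L M : lmodType (ft_alg K n)) :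
  (0 < r <= n)%N -> is_part r lam -> lam <> nseq r 1%N -> is_L r lam L ->
  (forall f (x : M), (ft_rank f < k)%N -> ft_delta K f *: x = 0) ->
  (r < k + m)%N -> ext_vanishes L M m.
Proof.
move=> /andP[r_gt0 rn] lamP lam1.
move=> [simpL Llow [phi [[phiS phiI phiO] phiK phiG]]] Mk rkm.
have ee := ft_ee r_gt0 rn.
have cornerP (x : L) : ft_corner r x <-> ft_delta K (ft_e n r) *: x = x.
  by split=> [[y ->]|<-]; [rewrite ft_delta_scaleM ee|exists x].
(* [phi] is a bare function that is linear only on the corner, so its value at 0 has to be
   derived. *)
have phi0 : phi 0 = 0.
  have c0 : ft_corner (K := K) (n := n) r (0 : L) by apply/cornerP; rewrite scaler0.
  have := phiK 1 0 0 c0 c0; rewrite scaler0 addr0 scale1r => /eqP.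
  by rewrite -subr_eq0 opprD addNKr oppr_eq0 => /eqP.
have no_sign (x : L) : ft_delta K (ft_e n r) *: x = x ->
    (forall i j, i != j -> ft_delta K (ft_perm r_gt0 rn (tperm i j)) *: x = - x) ->
    x = 0.
  move=> ex xs; have cx := (cornerP x).2 ex.
  apply: phiI; [exact: classical_sets.mem_set|apply: classical_sets.mem_set|].
    by apply/cornerP; rewrite scaler0.
  rewrite phi0; apply: (specht_no_sign lamP lam1); first exact: phiS.
  move=> i j ij.
  rewrite -(phiG _ _ _ (ft_perm_units r_gt0 rn _) (ft_perm_restr r_gt0 rn _) cx).
  rewrite xs //; have := phiK (-1) x 0 cx ((cornerP 0).2 (scaler0 _ _)).
  by rewrite phi0 !addr0 !scaleN1r.
(* A nonzero vector of the Specht module pulls back to a nonzero vector of the corner. *)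
have ex0 : exists x : L, ft_delta K (ft_e n r) *: x != 0.
  have [v vS v0] := specht_neq0 K lamP; have [x cx xv] := phiO v vS.
  exists x; rewrite ((cornerP x).1 cx); apply: contra_neq v0 => x0.
  by rewrite -xv x0.
have [i iK] := standard_retract Llow no_sign simpL ex0.
have fD : fin_dim (standard r L).
  apply: (standard_fin_dim (phi := phi)) =>
    [x y /eqP/cornerP xc /eqP/cornerP yc|c x y /cornerP xc /cornerP yc].
    by apply: phiI; exact: classical_sets.mem_set.
  exact: phiK.
move=> P; apply: (ext_vanishes_retract iK (Q := free_resolution (standard r L))).
exact: (grading_ext_vanishes (standard_grading r L) fD Mk rkm).
Qed.

Theorem proposition3p6 (R : realType) (n k r : nat)
  (hn : (1 <= n)%N) (hk : (1 <= k <= n)%N) (hr : (1 <= r <= n)%N)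
  (lam mu : seq nat)
  (hlam : is_part r lam) (hlam1 : lam <> nseq r 1%N) (hmu : is_part k mu)
  (L M : lmodType (ft_alg R[i] n)) (hL : is_L r lam L) (hM : is_L k mu M)
  (P : projres L) (m : nat)
  (hm : ~ [/\ 0 <= m%:Z, m%:Z <= r%:Z - k%:Z & r%:Z - k%:Z <= n%:Z - 1]) :
  forall x : Ext M P m, x = 0.
Proof.
apply/Ext_eq0P; have [_ Mlow _] := hM.
apply: (is_L_ext_vanishes hr hlam hlam1 hL Mlow).
(* Since [1 <= k] and [r <= n], the bound [r - k <= n - 1] always holds, so the excluded range
   amounts to [r < k + m]. *)
rewrite ltnNge; apply/negP => kmr; apply: hm; split; lia.
Qed.
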